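(* Let $1<a<b$ be relatively prime integers, let $r$ be a non-negative integer, let $S=S(a,b,r)$, and let $k$ be a commutative ring. The $\mathbb{W}(k)$-module $$\mathbb{W}_S(k)/(V_a\mathbb{W}_{S/a}(k)+V_b\mathbb{W}_{S/b}(k))$$ has finite length $\frac12(2r+1)(a-1)(b-1)$.
   Context: $\mathbb{N}$ is the set of positive integers. For $m\in\mathbb{N}$, $\ell(a,b,m)$ is the number of pairs $(i,j)$ of positive integers with $ai+bj=m$, and $S(a,b,r)=\{m\in\mathbb{N}\mid\ell(a,b,m)\leqslant r\}$, which is stable under division. For $S\subset\mathbb{N}$ stable under division and $n\in\mathbb{N}$, $S/n=\{s\in\mathbb{N}\mid ns\in S\}$. $\mathbb{W}_S(k)$ is the ring of big Witt vectors in $k$ indexed by $S$, $\mathbb{W}(k)=\mathbb{W}_{\mathbb{N}}(k)$, and $V_n:\mathbb{W}_{S/n}(k)\to\mathbb{W}_S(k)$ is the $n$th Verschiebung map. $\mathbb{W}_S(k)$ is viewed as a $\mathbb{W}(k)$-module via the restriction map $\mathbb{W}(k)\to\mathbb{W}_S(k)$, and the images of $V_a$ and $V_b$ are submodules.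
   Formalization: For a general commutative ring k (e.g. k = Z) the length claim fails; proved instead: a filtration with that many subquotients k, W(k) acting via the ghost maps w_m (m in S divisible by neither a nor b), for every k, and the usual length when k is a perfect field. *)

(* Defs.v *)
From HB Require Import structures.
From mathcomp Require Import all_boot all_order all_algebra finmap.
From mathcomp.multinomials Require Import monalg.
From mathcomp.classical Require Import boolp.

Set Implicit Arguments.
Unset Strict Implicit.
Unset Printing Implicit Defensive.

Import Order.TTheory GRing.Theory Num.Theory.
Local Open Scope ring_scope.

(* Big Witt vectors indexed by a truncation set, as commutative rings.

   The ring structure of W_S(k) is the functorial one for which every ghost
   map w_n : x |-> \sum_(d %| n) d x_d^(n/d), n \in S, is a ring morphism.
   Sums, opposites and products are given by universal integral polynomials in
   the coordinates; these are obtained over Z[X_(c,n) | c, n \in nat] by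
   inverting the ghost map, which Dwork's congruences allow.  Identities
   between the operations hold over Z[X] by comparison of ghost components
   and are then specialized to k.

   All rings are commutative with 1; the zero ring is allowed. *)

Definition wvar : choiceType := (nat * nat)%type.
Definition wpoly : Type := {malg int[{cmonom wvar}]}.
HB.instance Definition _ := GRing.ComNzRing.on wpoly.
Definition wmon (m : {cmonom wvar}) : wpoly := << m >>.
Definition wX (i : wvar) : wpoly := wmon (ucm i).

Lemma wmon1 : wmon mone = 1. Proof. by []. Qed.

Lemma wmonM m1 m2 : wmon (mmul m1 m2) = wmon m1 * wmon m2.
Proof. by rewrite /wmon [RHS]malgM_def fgmulUU mulr1. Qed.

Lemma wpC (c : int) : << c *g mone >> = c%:~R :> wpoly.
Proof. by rewrite -[in LHS](intz c) (rmorph_int (@malgC {cmonom wvar} int)). Qed.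

Lemma wpUE (c : int) m : << c *g m >> = c%:~R * wmon m :> wpoly.
Proof. by rewrite -wpC [RHS]malgM_def fgmulUU mulr1 mul1m. Qed.

Lemma wpolyE (f : wpoly) : f = \sum_(m <- msupp f) (f@_m)%:~R * wmon m.
Proof. by rewrite {1}(monalgE f); apply: eq_bigr => m _; apply: wpUE. Qed.

Section Eval.
Variables (k : comPzRingType) (v : wvar -> k).

Definition mon_eval (m : {cmonom wvar}) : k :=
  \prod_(i <- finsupp m) v i ^+ m i.
Definition wp_eval (f : wpoly) : k :=
  \sum_(m <- msupp f) (f@_m)%:~R * mon_eval m.

Lemma mon_evalEw (d : {fset wvar}) (m : {cmonom wvar}) : (finsupp m `<=` d)%fset ->
  mon_eval m = \prod_(i <- d) v i ^+ m i.
Proof.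
move=> le; rewrite /mon_eval (big_fset_incl _ le) // => i _.
by rewrite -cmE_eq0 => /eqP->.
Qed.

Lemma mon_eval1 : mon_eval mone = 1.
Proof. by rewrite /mon_eval mdom1 big_seq_fset0. Qed.

Lemma mon_evalM m1 m2 : mon_eval (mmul m1 m2) = mon_eval m1 * mon_eval m2.
Proof.
have u : (finsupp (mmul m1 m2) `<=` finsupp m1 `|` finsupp m2)%fset by rewrite mdomD.
have l := fsubsetUl (finsupp m1) (finsupp m2).
have r := fsubsetUr (finsupp m1) (finsupp m2).
rewrite (mon_evalEw u) (mon_evalEw l) (mon_evalEw r) -big_split /=.
by apply: eq_bigr => i _; rewrite cmM exprD.
Qed.

Lemma wp_evalEw (d : {fset {cmonom wvar}}) (f : wpoly) : (msupp f `<=` d)%fset ->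
  wp_eval f = \sum_(m <- d) (f@_m)%:~R * mon_eval m.
Proof.
move=> le; rewrite /wp_eval (big_fset_incl _ le) // => m _ /mcoeff_outdom->.
by rewrite mul0r.
Qed.

Lemma wp_evalU c m : wp_eval << c *g m >> = c%:~R * mon_eval m.
Proof. by rewrite (wp_evalEw msuppU_le) big_seq_fset1 mcoeffUU. Qed.

Fact wp_eval_zmod : zmod_morphism wp_eval.
Proof.
move=> f g; pose d := (msupp f `|` msupp g)%fset.
have lf : (msupp f `<=` d)%fset by apply: fsubsetUl.
have lg : (msupp g `<=` d)%fset by apply: fsubsetUr.
rewrite (wp_evalEw (msuppB_le f g)) (wp_evalEw lf) (wp_evalEw lg) -sumrB.
by apply: eq_bigr => m _; rewrite mcoeffB intrB mulrBl.
Qed.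
HB.instance Definition _ :=
  GRing.isZmodMorphism.Build wpoly k wp_eval wp_eval_zmod.

Fact wp_eval_monoid : monoid_morphism wp_eval.
Proof.
split; first by rewrite wp_evalU mon_eval1 mulr1.
move=> f g; rewrite malgME raddf_sum mulr_suml /=; apply: eq_bigr => i _.
rewrite raddf_sum mulr_sumr /=; apply: eq_bigr => j _.
by rewrite wp_evalU intrM mon_evalM mulrACA.
Qed.
HB.instance Definition _ :=
  GRing.isMonoidMorphism.Build wpoly k wp_eval wp_eval_monoid.

Lemma wp_evalX i : wp_eval (wX i) = v i.
Proof.
by rewrite /wX wp_evalU mul1r /mon_eval mdomU big_seq_fset1 cmUU expr1.
Qed.

End Eval.

Lemma wp_eval_comp (k l : comPzRingType) (h : {rmorphism k -> l}) v f :
  h (wp_eval v f) = wp_eval (h \o v) f.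
Proof.
rewrite /wp_eval raddf_sum /=; apply: eq_bigr => m _.
rewrite rmorphM rmorph_int rmorph_prod; congr (_ * _).
by apply: eq_bigr => i _; rewrite rmorphXn.
Qed.

Lemma wpoly_ind (P : wpoly -> Prop) :
  P 1 -> (forall i, P (wX i)) -> (forall f g, P f -> P g -> P (f - g)) ->
  (forall f g, P f -> P g -> P (f * g)) -> forall f, P f.
Proof.
move=> P1 PX PB PM.
have P0 : P 0 by rewrite -(subrr 1); apply: PB.
have PN f : P f -> P (- f) by move=> ?; rewrite -sub0r; apply: PB.
have PD f g : P f -> P g -> P (f + g).
  by move=> ? ?; rewrite -[g]opprK; apply: PB => //; apply: PN.
have Pn (n : nat) : P n%:R by elim: n => // n IH; rewrite -addn1 natrD; apply: PD.
have Pz (c : int) : P c%:~R.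
  by case: c => n; [apply: Pn | rewrite NegzE mulrNz; apply/PN/Pn].
have Pm (m : {cmonom wvar}) : P (wmon m).
  elim: {m}(mdeg m) {-2}m (erefl (mdeg m)) => [|n IH] m.
    by move/mdeg_eq0I->; rewrite wmon1.
  move=> dm; have: finsupp m != fset0.
    apply/eqP => e; move: dm; rewrite mdegE e big_seq_fset0; discriminate.
  case/fset0Pn => i; rewrite -cmE_neq0 -lt0n => mi.
  have em : m = mmul (ucm i) (divcm m (ucm i)).
    apply/eqP/cmP => j; rewrite cmM divcmE cmU.
    by case: eqP => [<-|]; rewrite ?subnKC ?subn0.
  rewrite em wmonM.
  apply: (PM _ _ (PX i)); apply: IH.
  by move: dm; rewrite {1}em mdegM mdegU add1n => -[].
move=> f; rewrite (wpolyE f); apply: (big_ind P P0 PD) => m _.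
exact: (PM _ _ (Pz _) (Pm _)).
Qed.

Lemma wpoly_torsion (n : nat) (f : wpoly) : (0 < n)%N -> f *+ n = 0 -> f = 0.
Proof.
move=> n0 e; apply/malgP => m; rewrite mcoeff0.
have /eqP := congr1 (mcoeff m) e; rewrite mcoeffMn mcoeff0 mulrn_eq0.
by rewrite -leqn0 leqNgt n0 => /eqP.
Qed.

Definition wp_div (n : nat) (f : wpoly) : wpoly :=
  [malg m in msupp f => (f@_m %/ n)%Z].

Lemma wp_divK (n : nat) f :
  (forall m, (n %| `|f@_m|)%N) -> wp_div n f *+ n = f.
Proof.
move=> dvf; apply/malgP => m; rewrite mcoeffMn mcoeffE.
case: msuppP => [_|_]; last by rewrite mul0rn.
by rewrite -mulr_natr natz divzK ?dvdzE.
Qed.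

Section Congruence.
Variable R : comPzRingType.

Definition eqm (n : nat) (x y : R) := exists c, x = y + c *+ n.

Lemma eqm_refl n x : eqm n x x.
Proof. by exists 0; rewrite mul0rn addr0. Qed.

Lemma eqm_sym n x y : eqm n x y -> eqm n y x.
Proof. by case=> c ->; exists (- c); rewrite mulNrn addrK. Qed.

Lemma eqm_trans n y x z : eqm n x y -> eqm n y z -> eqm n x z.
Proof. by case=> c -> [d ->]; exists (d + c); rewrite -addrA mulrnDl. Qed.

Lemma eqmD n x y x' y' : eqm n x y -> eqm n x' y' -> eqm n (x + x') (y + y').
Proof. by case=> c -> [d ->]; exists (c + d); rewrite mulrnDl addrACA. Qed.

Lemma eqmN n x y : eqm n x y -> eqm n (- x) (- y).
Proof. by case=> c ->; exists (- c); rewrite mulNrn opprD. Qed.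

Lemma eqmB n x y x' y' : eqm n x y -> eqm n x' y' -> eqm n (x - x') (y - y').
Proof. by move=> e /eqmN; apply: eqmD. Qed.

Lemma eqmM n x y x' y' : eqm n x y -> eqm n x' y' -> eqm n (x * x') (y * y').
Proof.
case=> c -> [d ->]; exists (y * d + c * y' + c * d *+ n).
by rewrite mulrDl !mulrDr !mulrnDl !mulrnAr !mulrnAl !addrA.
Qed.

Lemma eqmX n x y e : eqm n x y -> eqm n (x ^+ e) (y ^+ e).
Proof.
move=> h; elim: e => [|e IH]; first by rewrite !expr0; apply: eqm_refl.
by rewrite !exprS; apply: eqmM.
Qed.

Lemma eqm_sum n (I : Type) (s : seq I) (P : pred I) F G :
  (forall i, P i -> eqm n (F i) (G i)) ->
  eqm n (\sum_(i <- s | P i) F i) (\sum_(i <- s | P i) G i).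
Proof.
move=> h; elim/big_rec2: _ => [|i y1 y2 Pi]; first exact: eqm_refl.
by apply: eqmD; apply: h.
Qed.

Lemma eqmMn n x y d : eqm n x y -> eqm (n * d) (x *+ d) (y *+ d).
Proof. by case=> c ->; exists c; rewrite mulrnDl mulrnA. Qed.

Lemma eqm_dvd n m x y : (m %| n)%N -> eqm n x y -> eqm m x y.
Proof. by case/dvdnP => q -> [c ->]; exists (c *+ q); rewrite -mulrnA. Qed.

Lemma eqm_pow_step p j x y : (0 < j)%N ->
  eqm (p ^ j) x y -> eqm (p ^ j.+1) (x ^+ p) (y ^+ p).
Proof.
case: p => [|p] j0 e; first by rewrite !expr0; apply: eqm_refl.
have [c ec] := e; have e1 : eqm p.+1 x y by apply: eqm_dvd e; apply: dvdn_exp.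
suff [d ed] : eqm p.+1 (\sum_(i < p.+1) x ^+ (p.+1.-1 - i) * y ^+ i) 0.
  exists (c * d); apply/eqP; rewrite addrC -subr_eq; apply/eqP.
  rewrite subrXX ed add0r ec addrC addKr.
  by rewrite mulrnAl mulrnAr -mulrnA expnS mulnC.
apply: (@eqm_trans _ (\sum_(i < p.+1) y ^+ p)).
  apply: eqm_sum => i _.
  have -> : y ^+ p = y ^+ (p - i) * y ^+ i by rewrite -exprD subnK // -ltnS.
  by apply: eqmM; [apply: eqmX | apply: eqm_refl].
by exists (y ^+ p); rewrite sumr_const card_ord add0r.
Qed.

Lemma eqm_pow p j x y : eqm p x y ->
  eqm (p ^ j.+1) (x ^+ (p ^ j)) (y ^+ (p ^ j)).
Proof.
move=> e; elim: j => [|j IH]; first by rewrite expn1 expn0 !expr1.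
by rewrite [(p ^ j.+1)%N]expnSr !exprM; apply: eqm_pow_step.
Qed.

Lemma eqm_frobD p x y : prime p -> eqm p ((x + y) ^+ p) (x ^+ p + y ^+ p).
Proof.
move=> pr; rewrite exprDn; case: p pr => [|p] // pr.
rewrite big_ord_recl big_ord_recr /= !subn0 subnn bin0 binn !expr0 mulr1 mul1r.
rewrite !mulr1n -[in X in eqm _ _ X](add0r (y ^+ p.+1)).
apply: eqmD; first exact: eqm_refl.
apply: eqmD; last exact: eqm_refl.
have {2}<- : \sum_(i < p) 0 = 0 :> R by rewrite big1.
apply: eqm_sum => i _.
have /dvdnP[q ->] : (p.+1 %| 'C(p.+1, bump 0 i))%N.
  by apply: prime_dvd_bin => //; rewrite /bump add1n /= ltnS.
by exists (x ^+ (p.+1 - bump 0 i) * y ^+ bump 0 i *+ q); rewrite add0r mulrnA.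
Qed.

End Congruence.

(* Only meaningful for 0 < n, since divisors 0 = [:: 1]. *)
Section Ghost.
Variable k : comPzRingType.
Implicit Types (x y : nat -> k) (n : nat).

Definition ghost n x : k := \sum_(d <- divisors n) x d ^+ (n %/ d) *+ d.

Lemma eq_ghost n x y : (0 < n)%N -> (forall d, (d %| n)%N -> x d = y d) ->
  ghost n x = ghost n y.
Proof.
move=> n0 e; rewrite /ghost big_seq [RHS]big_seq; apply: eq_bigr => d.
by rewrite -dvdn_divisors // => /e->.
Qed.

Lemma ghostD1 n x : (0 < n)%N ->
  ghost n x = x n *+ n + \sum_(d <- divisors n | d != n) x d ^+ (n %/ d) *+ d.
Proof.
move=> n0; rewrite /ghost (bigD1_seq n) ?divisors_uniq ?divisors_id //=.
by rewrite divnn n0 expr1.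
Qed.

Lemma eq_ghostD1 n x y : (0 < n)%N ->
  (forall d, (0 < d < n)%N -> (d %| n)%N -> x d = y d) ->
  \sum_(d <- divisors n | d != n) x d ^+ (n %/ d) *+ d =
  \sum_(d <- divisors n | d != n) y d ^+ (n %/ d) *+ d.
Proof.
move=> n0 e; rewrite big_seq_cond [RHS]big_seq_cond.
apply: eq_bigr => d /andP[]; rewrite -dvdn_divisors // => dn dn'.
by rewrite e // (dvdn_gt0 n0 dn) ltn_neqAle dn' dvdn_leq.
Qed.

End Ghost.

Lemma rmorph_ghost (k l : comPzRingType) (h : {rmorphism k -> l}) n x :
  h (ghost n x) = ghost n (h \o x).
Proof.
rewrite /ghost raddf_sum /=; apply: eq_bigr => d _.
by rewrite rmorphMn rmorphXn.
Qed.

Definition frob (p : nat) : wpoly -> wpoly := wp_eval (fun i => wX i ^+ p).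

Lemma frobP p f : prime p -> eqm p (f ^+ p) (frob p f).
Proof.
move=> pr; elim/wpoly_ind: f => [|i|f g ef eg|f g ef eg].
- by rewrite expr1n /frob rmorph1; apply: eqm_refl.
- by rewrite /frob wp_evalX; apply: eqm_refl.
- rewrite /frob rmorphB /= -/(frob p f) -/(frob p g).
  have e := eqm_frobD (f - g) g pr; rewrite subrK in e.
  have := eqmB (eqm_sym e) (eqm_refl p (g ^+ p)); rewrite addrK => e1.
  exact: (eqm_trans e1 (eqmB ef eg)).
- rewrite /frob rmorphM /= -/(frob p f) -/(frob p g) exprMn.
  exact: (eqmM ef eg).
Qed.

Lemma frob_term p d e (x : wpoly) : prime p -> (0 < d)%N -> (0 < e)%N ->
  eqm (p ^ logn p (d * (p * e))) (x ^+ (p * e) *+ d) (frob p x ^+ e *+ d).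
Proof.
move=> pr d0 e0; have p0 := prime_gt0 pr.
have [e' ee] : exists e', e = (p ^ logn p e * e')%N.
  by have /dvdnP[q eq] := pfactor_dvdnn p e; exists q; rewrite mulnC.
apply: (@eqm_dvd _ (p ^ (logn p e).+1 * d)).
  rewrite !lognM ?muln_gt0 ?p0 // (logn_prime p pr) eqxx add1n expnD mulnC.
  by rewrite dvdn_mul // pfactor_dvdnn.
apply: eqmMn; rewrite exprM [in X in eqm _ X _]ee [in X in eqm _ _ (_ ^+ X)]ee.
by rewrite !exprM; apply/eqmX/eqm_pow/frobP.
Qed.

(* Dwork's congruence w_n(x) = phi_p (w_(n/p)(x)) mod p^(v_p n), where
   phi_p is the lift of Frobenius raising the variables to the pth power. *)
Lemma ghost_dwork p n (x : nat -> wpoly) : prime p -> (0 < n)%N -> (p %| n)%N ->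
  eqm (p ^ logn p n) (ghost n x) (frob p (ghost (n %/ p) x)).
Proof.
move=> pr n0 pn; have p0 := prime_gt0 pr.
have m0 : (0 < n %/ p)%N by rewrite divn_gt0 // dvdn_leq.
rewrite /frob rmorph_ghost {1}/ghost (bigID (fun d => (d %| n %/ p)%N)) /=.
rewrite -[X in eqm _ _ X]addr0; apply: eqmD.
  have pe : perm_eq (divisors (n %/ p))
                    [seq d <- divisors n | (d %| n %/ p)%N].
    apply: uniq_perm; rewrite ?filter_uniq ?divisors_uniq // => d.
    rewrite mem_filter -!dvdn_divisors //; symmetry; rewrite andb_idr // => /dvdn_trans; apply.
    by rewrite -{2}(divnK pn) dvdn_mulr.
  rewrite /ghost (perm_big _ pe) big_filter /=.
  apply: eqm_sum => d /dvdnP[e ed].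
  have en : n = (d * (p * e))%N by rewrite mulnCA mulnC (mulnC d) -ed divnK.
  have /andP[d0 e0] : (0 < d)%N && (0 < e)%N by rewrite -muln_gt0 mulnC -ed.
  have nd : (n %/ d = p * e)%N by rewrite {1}en mulKn.
  rewrite ed mulnK // nd en.
  exact: (frob_term _ pr d0 e0).
rewrite big_seq_cond.
have {2}<- : \sum_(d <- divisors n | (d \in divisors n) && ~~ (d %| n %/ p)%N)
    0 = 0 :> wpoly by rewrite big1.
apply: eqm_sum => d /andP[]; rewrite -dvdn_divisors // => /dvdnP[q eq] nd.
have d0 : (0 < d)%N by move: n0; rewrite eq muln_gt0 => /andP[].
have npq : ~~ (p %| q)%N.
  apply: contra nd => /dvdnP[s es]; apply/dvdnP; exists s.
  by rewrite eq es mulnAC mulnK.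
have q0 : (0 < q)%N by move: n0; rewrite eq muln_gt0 => /andP[].
have -> : logn p n = logn p d.
  by rewrite eq lognM // (eqP (_ : logn p q == 0%N)) // -leqn0 leqNgt logn_gt0 mem_primes (negPf npq) !andbF.
have /dvdnP[s es] := pfactor_dvdnn p d.
by exists (x d ^+ (n %/ d) *+ s); rewrite add0r -mulrnA -es.
Qed.

Fixpoint unghost_seq (g : nat -> wpoly) n : seq wpoly :=
  if n is m.+1 then
    let u := unghost_seq g m in
    rcons u (wp_div m
      (g m - \sum_(d <- divisors m | d != m) u`_d ^+ (m %/ d) *+ d))
  else [::].

Definition unghost g n := (unghost_seq g n.+1)`_n.

Lemma size_unghost_seq g n : size (unghost_seq g n) = n.
Proof. by elim: n => //= n IH; rewrite size_rcons IH. Qed.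

Lemma nth_unghost_seq g N n : (n < N)%N -> (unghost_seq g N)`_n = unghost g n.
Proof.
elim: N => // N IH; rewrite ltnS leq_eqVlt => /predU1P[->//|nN].
by rewrite /= nth_rcons size_unghost_seq nN IH.
Qed.

Lemma unghostE g n : (0 < n)%N -> unghost g n = wp_div n
  (g n - \sum_(d <- divisors n | d != n) unghost g d ^+ (n %/ d) *+ d).
Proof.
move=> n0; rewrite {1}/unghost /= nth_rcons size_unghost_seq ltnn eqxx.
apply: (congr1 (fun s => wp_div n (g n - s))).
apply: eq_ghostD1 => // d /andP[_ dn] _.
exact: (nth_unghost_seq _ dn).
Qed.

Definition dwork (g : nat -> wpoly) := forall p n, prime p -> (0 < n)%N ->
  (p %| n)%N -> eqm (p ^ logn p n) (g n) (frob p (g (n %/ p)%N)).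

Lemma unghostP g : dwork g -> forall n, (0 < n)%N -> ghost n (unghost g) = g n.
Proof.
move=> dg; elim/ltn_ind=> n IH n0; rewrite ghostD1 // [in unghost g n]unghostE //.
set h := g n - _; suff dvh m : (n %| `|h@_m|)%N.
  by rewrite wp_divK // /h subrK.
apply/dvdn_partP => // p; rewrite mem_primes => /and3P[pr _ pn]; rewrite p_part.
have p1 := prime_gt1 pr; have p0 := prime_gt0 pr.
have m0 : (0 < n %/ p)%N by rewrite divn_gt0 // dvdn_leq.
suff [c ->] : eqm (p ^ logn p n) h 0.
  by rewrite add0r mcoeffMn -mulr_natr abszM natz absz_nat dvdn_mull.
have [c ec] : eqm (p ^ logn p n) (unghost g n *+ n) 0.
  have /dvdnP[s es] := pfactor_dvdnn p n.
  by exists (unghost g n *+ s); rewrite add0r -mulrnA -es.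
have -> : h = g n - (ghost n (unghost g) - unghost g n *+ n).
  by rewrite ghostD1 // [_ *+ n + _]addrC addrK.
rewrite -[X in eqm _ _ X](subrr (frob p (g (n %/ p)%N))).
apply: eqmB; first exact: dg.
rewrite -[X in eqm _ _ X]subr0; apply: eqmB; last by exists c.
rewrite -IH ?ltn_Pdiv //; exact: ghost_dwork.
Qed.

Lemma ghost_inj (k : comPzRingType) (u v : nat -> k) n :
  (forall m (a : k), (0 < m)%N -> a *+ m = 0 -> a = 0) -> (0 < n)%N ->
  (forall m, (m %| n)%N -> ghost m u = ghost m v) -> u n = v n.
Proof.
move=> tf; elim/ltn_ind: n => n IH n0 e; have en := e n (dvdnn n).
rewrite (ghostD1 u n0) (ghostD1 v n0) in en.
have IH' d : (0 < d < n)%N -> (d %| n)%N -> u d = v d.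
  move=> /andP[d0 dn] dn'; apply: (IH d dn d0) => m md.
  exact: (e m (dvdn_trans md dn')).
rewrite (eq_ghostD1 n0 IH') in en; move: en.
move/addIr/eqP; rewrite -subr_eq0 -mulrnBl => /eqP/(tf _ _ n0)/eqP.
by rewrite subr_eq0 => /eqP.
Qed.

Lemma unghost_ex g : dwork g ->
  {u : nat -> wpoly | forall n, (0 < n)%N -> ghost n u = g n}.
Proof. by move=> dg; exists (unghost g); apply: unghostP. Qed.

Definition wXs (c : nat) : nat -> wpoly := fun n => wX (c, n).

Fact dworkX c : dwork (fun n => ghost n (wXs c)).
Proof. by move=> p n; apply: ghost_dwork. Qed.

Fact dworkD : dwork (fun n => ghost n (wXs 0) + ghost n (wXs 1)).
Proof.
move=> p n pr n0 pn; rewrite /frob rmorphD /=.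
exact: (eqmD (dworkX 0 pr n0 pn) (dworkX 1 pr n0 pn)).
Qed.

Fact dworkN : dwork (fun n => - ghost n (wXs 0)).
Proof.
move=> p n pr n0 pn; rewrite /frob rmorphN /=.
exact: (eqmN (dworkX 0 pr n0 pn)).
Qed.

Fact dworkM : dwork (fun n => ghost n (wXs 0) * ghost n (wXs 1)).
Proof.
move=> p n pr n0 pn; rewrite /frob rmorphM /=.
exact: (eqmM (dworkX 0 pr n0 pn) (dworkX 1 pr n0 pn)).
Qed.

Fact dworkF a : (0 < a)%N -> dwork (fun n => ghost (a * n) (wXs 0)).
Proof.
move=> a0 p n pr n0 pn; rewrite muln_divA //.
apply: (@eqm_dvd _ (p ^ logn p (a * n))).
  by rewrite lognM // expnD dvdn_mull.
by apply: ghost_dwork; rewrite ?muln_gt0 ?a0 ?dvdn_mull.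
Qed.

(* The vectors over Z[X] whose ghost components are the sum, the opposite, the
   product of those of X_0 and X_1, and w_((a+1) n)(X_0), respectively. *)
Definition add_poly := sval (unghost_ex dworkD).
Definition opp_poly := sval (unghost_ex dworkN).
Definition mul_poly := sval (unghost_ex dworkM).
Definition frob_poly a := sval (unghost_ex (@dworkF a.+1 isT)).

Section GhostHom.
Variables (A k : comPzRingType) (h : {rmorphism A -> k}) (n : nat).
Variables (u X Y : nat -> A) (x y : nat -> k).
Hypotheses (hX : h \o X = x) (hY : h \o Y = y).

Lemma ghost_homD : ghost n u = ghost n X + ghost n Y ->
  ghost n (h \o u) = ghost n x + ghost n y.
Proof. by move=> e; rewrite -hX -hY -!rmorph_ghost e rmorphD. Qed.

Lemma ghost_homN : ghost n u = - ghost n X -> ghost n (h \o u) = - ghost n x.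
Proof. by move=> e; rewrite -hX -!rmorph_ghost e rmorphN. Qed.

Lemma ghost_homM : ghost n u = ghost n X * ghost n Y ->
  ghost n (h \o u) = ghost n x * ghost n y.
Proof. by move=> e; rewrite -hX -hY -!rmorph_ghost e rmorphM. Qed.

Lemma ghost_homF m : ghost n u = ghost m X -> ghost n (h \o u) = ghost m x.
Proof. by move=> e; rewrite -hX -!rmorph_ghost e. Qed.

End GhostHom.

Section Raw.
Variable k : comPzRingType.
Implicit Types (x y : nat -> k) (l : seq (nat -> k)) (u : nat -> wpoly).

(* Vectors are represented by functions on nat; the value at 0 is junk. *)
Definition env l (i : wvar) : k := nth (fun=> 0) l i.1 i.2.
Definition raw_op u l n : k := wp_eval (env l) (u n).

Definition raw_add x y := raw_op add_poly [:: x; y].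
Definition raw_opp x := raw_op opp_poly [:: x].
Definition raw_mul x y := raw_op mul_poly [:: x; y].
Definition raw_one n : k := (n == 1%N)%:R.
Definition raw_F a x := raw_op (frob_poly a.-1) [:: x].
Definition raw_V a x n : k := if (a %| n)%N then x (n %/ a)%N else 0.

Lemma env_comp l c : wp_eval (env l) \o wXs c = nth (fun=> 0) l c.
Proof. by apply: funext => n; apply: wp_evalX. Qed.

Lemma ghost_add n x y : (0 < n)%N ->
  ghost n (raw_add x y) = ghost n x + ghost n y.
Proof.
move=> n0; have e := svalP (unghost_ex dworkD) n n0.
exact: (ghost_homD (env_comp [:: x; y] 0) (env_comp [:: x; y] 1) e).
Qed.

Lemma ghost_opp n x : (0 < n)%N -> ghost n (raw_opp x) = - ghost n x.
Proof.
move=> n0; have e := svalP (unghost_ex dworkN) n n0.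
exact: (ghost_homN (env_comp [:: x] 0) e).
Qed.

Lemma ghost_mul n x y : (0 < n)%N ->
  ghost n (raw_mul x y) = ghost n x * ghost n y.
Proof.
move=> n0; have e := svalP (unghost_ex dworkM) n n0.
exact: (ghost_homM (env_comp [:: x; y] 0) (env_comp [:: x; y] 1) e).
Qed.

Lemma ghost_F a n x : (0 < a)%N -> (0 < n)%N ->
  ghost n (raw_F a x) = ghost (a * n) x.
Proof.
case: a => // a _ n0; have e := svalP (unghost_ex (@dworkF a.+1 isT)) n n0.
exact: (ghost_homF (env_comp [:: x] 0) e).
Qed.

Lemma expr0_div n d : (0 < n)%N -> (d %| n)%N -> (0 : k) ^+ (n %/ d) = 0.
Proof.
move=> n0 dn; have d0 := dvdn_gt0 n0 dn.
have: (0 < n %/ d)%N by rewrite divn_gt0 // dvdn_leq.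
by case: (n %/ d)%N => // m _; rewrite expr0n.
Qed.

Lemma ghost0 n : (0 < n)%N -> ghost n (fun=> 0) = 0 :> k.
Proof.
move=> n0; rewrite /ghost big_seq big1 // => d; rewrite -dvdn_divisors // => dn.
by rewrite expr0_div // mul0rn.
Qed.

Lemma ghost1 n : (0 < n)%N -> ghost n raw_one = 1.
Proof.
move=> n0; rewrite /ghost (bigD1_seq 1%N) ?divisors_uniq //=; last first.
  by rewrite -dvdn_divisors ?dvd1n.
rewrite expr1n big_seq_cond big1 ?addr0 // => d /andP[].
rewrite -dvdn_divisors // /raw_one => dn /negPf->.
by rewrite expr0_div // mul0rn.
Qed.

Lemma ghost_V a n x : (0 < a)%N -> (0 < n)%N ->
  ghost n (raw_V a x) = if (a %| n)%N then ghost (n %/ a) x *+ a else 0.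
Proof.
move=> a0 n0; rewrite {1}/ghost (bigID (fun d => (a %| d)%N)) /= addrC.
rewrite big_seq_cond big1 ?add0r; last first.
  move=> d /andP[]; rewrite -dvdn_divisors // /raw_V => dn /negPf->.
  by rewrite expr0_div // mul0rn.
case: ifPn => [/dvdnP[m em]|an]; last first.
  rewrite big_seq_cond big1 // => d /andP[]; rewrite -dvdn_divisors // => dn ad.
  by rewrite (dvdn_trans ad dn) in an.
have m0 : (0 < m)%N by move: n0; rewrite em muln_gt0 => /andP[].
have pe : perm_eq [seq (a * d)%N | d <- divisors m]
                  [seq d <- divisors n | (a %| d)%N].
  apply: uniq_perm; rewrite ?filter_uniq ?divisors_uniq //.
    rewrite map_inj_uniq ?divisors_uniq // => d d' /eqP.
    by rewrite eqn_pmul2l // => /eqP.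
  move=> d; rewrite mem_filter -dvdn_divisors //.
  apply/mapP/andP => [[e]|[/dvdnP[e ->]]].
    rewrite -dvdn_divisors // => ed ->; rewrite dvdn_mulr //; split => //.
    by rewrite em mulnC dvdn_pmul2r.
  rewrite em dvdn_pmul2r // => ed; exists e; last by rewrite mulnC.
  by rewrite -dvdn_divisors.
rewrite -big_filter -(perm_big _ pe) big_map em mulnK // /ghost -sumrMnl.
apply: eq_bigr => d _; rewrite /raw_V dvdn_mulr // mulKn //.
by rewrite mulnC divnMl // mulrnA mulrnAC.
Qed.

End Raw.

Section Natural.
Variables (k l : comPzRingType) (h : {rmorphism k -> l}).
Implicit Types x y : nat -> k.

Lemma raw_op_nat u (xs : seq (nat -> k)) :
  h \o raw_op u xs = raw_op u [seq h \o x | x <- xs].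
Proof.
apply: funext => n; rewrite /= wp_eval_comp; congr (wp_eval _ _).
apply: funext => -[c d]; rewrite /= /env /=.
have [cs|cs] := ltnP c (size xs); first by rewrite (nth_map (fun=> 0)).
by rewrite !nth_default ?size_map // rmorph0.
Qed.

Lemma raw_add_nat x y : h \o raw_add x y = raw_add (h \o x) (h \o y).
Proof. exact: raw_op_nat. Qed.
Lemma raw_opp_nat x : h \o raw_opp x = raw_opp (h \o x).
Proof. exact: raw_op_nat. Qed.
Lemma raw_mul_nat x y : h \o raw_mul x y = raw_mul (h \o x) (h \o y).
Proof. exact: raw_op_nat. Qed.
Lemma raw_F_nat a x : h \o raw_F a x = raw_F a (h \o x).
Proof. exact: raw_op_nat. Qed.
Lemma raw_V_nat a x : h \o raw_V a x = raw_V a (h \o x).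
Proof.
by apply: funext => n; rewrite /= /raw_V; case: ifP => //; rewrite rmorph0.
Qed.
Lemma raw_0_nat : h \o (fun=> 0 : k) = (fun=> 0) :> (nat -> l).
Proof. by apply: funext => n /=; rewrite rmorph0. Qed.
Lemma raw_1_nat : h \o @raw_one k = @raw_one l.
Proof. by apply: funext => n; rewrite /= rmorph_nat. Qed.

End Natural.

Definition raw_nat := (raw_add_nat, raw_opp_nat, raw_mul_nat, raw_F_nat,
  raw_V_nat, raw_0_nat, raw_1_nat).

(* An identity between natural operations on vectors holds over every
   commutative ring as soon as it holds on ghost components. *)
Lemma raw_transfer
    (L R : forall k : comPzRingType, (nat -> nat -> k) -> nat -> k) n :
  (0 < n)%N ->
  (forall (k l : comPzRingType) (h : {rmorphism k -> l}) xs,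
     h \o L k xs = L l (fun c => h \o xs c)) ->
  (forall (k l : comPzRingType) (h : {rmorphism k -> l}) xs,
     h \o R k xs = R l (fun c => h \o xs c)) ->
  (forall (k : comPzRingType) xs m, (0 < m)%N -> (m %| n)%N ->
     ghost m (L k xs) = ghost m (R k xs)) ->
  forall (k : comPzRingType) xs, L k xs n = R k xs n.
Proof.
move=> n0 Ln Rn e k xs.
pose h : {rmorphism wpoly -> k} := wp_eval (fun i : wvar => xs i.1 i.2).
have eL : L k xs n = h (L wpoly wXs n).
  rewrite -[RHS]/((h \o L wpoly wXs) n) Ln; congr (L k _ n).
  by apply: funext => c; apply: funext => d; rewrite /= /wXs wp_evalX.
have eR : R k xs n = h (R wpoly wXs n).
  rewrite -[RHS]/((h \o R wpoly wXs) n) Rn; congr (R k _ n).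
  by apply: funext => c; apply: funext => d; rewrite /= /wXs wp_evalX.
rewrite eL eR; apply: (congr1 h); apply: (ghost_inj wpoly_torsion n0) => m mn.
exact: (e wpoly wXs m (dvdn_gt0 n0 mn) mn).
Qed.

Ltac raw_side := try (by move=> ? ? ? ?; rewrite !raw_nat).

Section RawLaws.
Variable k : comPzRingType.
Implicit Types x y z : nat -> k.
Local Notation seq3 x y z := (fun c => nth (fun=> 0 : k) [:: x; y; z] c).

Lemma raw_addA n x y z : (0 < n)%N ->
  raw_add x (raw_add y z) n = raw_add (raw_add x y) z n.
Proof.
move=> n0; apply: (@raw_transfer
  (fun k xs => raw_add (xs 0) (raw_add (xs 1) (xs 2)))
  (fun k xs => raw_add (raw_add (xs 0) (xs 1)) (xs 2)) n n0 _ _ _ k (seq3 x y z));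
  raw_side.
by move=> k' xs m m0 _; rewrite !ghost_add // addrA.
Qed.

Lemma raw_addC n x y : (0 < n)%N -> raw_add x y n = raw_add y x n.
Proof.
move=> n0; apply: (@raw_transfer
  (fun k xs => raw_add (xs 0) (xs 1)) (fun k xs => raw_add (xs 1) (xs 0))
  n n0 _ _ _ k (seq3 x y x)); raw_side.
by move=> k' xs m m0 _; rewrite !ghost_add // addrC.
Qed.

Lemma raw_add0 n x : (0 < n)%N -> raw_add (fun=> 0) x n = x n.
Proof.
move=> n0; apply: (@raw_transfer
  (fun k xs => raw_add (fun=> 0) (xs 0)) (fun k xs => xs 0)
  n n0 _ _ _ k (seq3 x x x)); raw_side.
- by [].
by move=> k' xs m m0 _; rewrite ghost_add // ghost0 // add0r.
Qed.

Lemma raw_addN n x : (0 < n)%N -> raw_add (raw_opp x) x n = 0.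
Proof.
move=> n0; apply: (@raw_transfer
  (fun k xs => raw_add (raw_opp (xs 0)) (xs 0)) (fun k xs => (fun=> 0))
  n n0 _ _ _ k (seq3 x x x)); raw_side.
by move=> k' xs m m0 _; rewrite ghost_add // ghost_opp // ghost0 // addNr.
Qed.

Lemma raw_mulA n x y z : (0 < n)%N ->
  raw_mul x (raw_mul y z) n = raw_mul (raw_mul x y) z n.
Proof.
move=> n0; apply: (@raw_transfer
  (fun k xs => raw_mul (xs 0) (raw_mul (xs 1) (xs 2)))
  (fun k xs => raw_mul (raw_mul (xs 0) (xs 1)) (xs 2)) n n0 _ _ _ k (seq3 x y z));
  raw_side.
by move=> k' xs m m0 _; rewrite !ghost_mul // mulrA.
Qed.

Lemma raw_mulC n x y : (0 < n)%N -> raw_mul x y n = raw_mul y x n.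
Proof.
move=> n0; apply: (@raw_transfer
  (fun k xs => raw_mul (xs 0) (xs 1)) (fun k xs => raw_mul (xs 1) (xs 0))
  n n0 _ _ _ k (seq3 x y x)); raw_side.
by move=> k' xs m m0 _; rewrite !ghost_mul // mulrC.
Qed.

Lemma raw_mul1 n x : (0 < n)%N -> raw_mul (@raw_one k) x n = x n.
Proof.
move=> n0; apply: (@raw_transfer
  (fun k xs => raw_mul (@raw_one k) (xs 0)) (fun k xs => xs 0)
  n n0 _ _ _ k (seq3 x x x)); raw_side.
- by [].
by move=> k' xs m m0 _; rewrite ghost_mul // ghost1 // mul1r.
Qed.

Lemma raw_mulDl n x y z : (0 < n)%N ->
  raw_mul (raw_add x y) z n = raw_add (raw_mul x z) (raw_mul y z) n.
Proof.
move=> n0; apply: (@raw_transfer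
  (fun k xs => raw_mul (raw_add (xs 0) (xs 1)) (xs 2))
  (fun k xs => raw_add (raw_mul (xs 0) (xs 2)) (raw_mul (xs 1) (xs 2)))
  n n0 _ _ _ k (seq3 x y z)); raw_side.
by move=> k' xs m m0 _; rewrite !(ghost_mul, ghost_add) // mulrDl.
Qed.

Lemma raw_VD a n x y : (0 < a)%N -> (0 < n)%N ->
  raw_V a (raw_add x y) n = raw_add (raw_V a x) (raw_V a y) n.
Proof.
move=> a0 n0; apply: (@raw_transfer
  (fun k xs => raw_V a (raw_add (xs 0) (xs 1)))
  (fun k xs => raw_add (raw_V a (xs 0)) (raw_V a (xs 1)))
  n n0 _ _ _ k (seq3 x y x)); raw_side.
move=> k' xs m m0 _; rewrite [in RHS]ghost_add // !ghost_V //.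
case: ifP => [am|_]; last by rewrite addr0.
by rewrite ghost_add ?mulrnDl // divn_gt0 // dvdn_leq.
Qed.

Lemma raw_VM a n x y : (0 < a)%N -> (0 < n)%N ->
  raw_mul x (raw_V a y) n = raw_V a (raw_mul (raw_F a x) y) n.
Proof.
move=> a0 n0; apply: (@raw_transfer
  (fun k xs => raw_mul (xs 0) (raw_V a (xs 1)))
  (fun k xs => raw_V a (raw_mul (raw_F a (xs 0)) (xs 1)))
  n n0 _ _ _ k (seq3 x y x)); raw_side.
move=> k' xs m m0 _; rewrite [in LHS]ghost_mul // !ghost_V //.
case: ifP => [am|_]; last by rewrite mulr0.
have m1 : (0 < m %/ a)%N by rewrite divn_gt0 // dvdn_leq.
by rewrite ghost_mul // ghost_F // mulrnAr mulnC divnK.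
Qed.

End RawLaws.

Section Local.

Definition raw_mask (k : comPzRingType) n (x : nat -> k) d :=
  if (d %| n)%N then x d else 0.

Lemma raw_mask_nat (k l : comPzRingType) (h : {rmorphism k -> l}) n x :
  h \o raw_mask n x = raw_mask n (h \o x).
Proof.
by apply: funext => d; rewrite /= /raw_mask; case: ifP => // _; rewrite rmorph0.
Qed.

Lemma eq_mask (k : comPzRingType) n (x y : nat -> k) :
  (forall d, (d %| n)%N -> x d = y d) -> raw_mask n x = raw_mask n y.
Proof.
by move=> e; apply: funext => d; rewrite /raw_mask; case: ifP => // /e.
Qed.

Lemma ghost_mask (k : comPzRingType) n m (x : nat -> k) :
  (0 < m)%N -> (m %| n)%N -> ghost m (raw_mask n x) = ghost m x.
Proof.
move=> m0 mn; apply: eq_ghost => // d dm.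
by rewrite /raw_mask (dvdn_trans dm mn).
Qed.

Variable k : comPzRingType.
Implicit Types x y : nat -> k.
Local Notation seq2 x y := (fun c => nth (fun=> 0 : k) [:: x; y] c).

Lemma raw_add_mask n x y : (0 < n)%N ->
  raw_add (raw_mask n x) (raw_mask n y) n = raw_add x y n.
Proof.
move=> n0; apply: (@raw_transfer
  (fun k xs => raw_add (raw_mask n (xs 0)) (raw_mask n (xs 1)))
  (fun k xs => raw_add (xs 0) (xs 1)) n n0 _ _ _ k (seq2 x y)).
- by move=> ? ? ? ?; rewrite !(raw_nat, raw_mask_nat).
- by move=> ? ? ? ?; rewrite !raw_nat.
by move=> k' xs m m0 mn; rewrite !ghost_add // !ghost_mask.
Qed.

Lemma raw_mul_mask n x y : (0 < n)%N ->
  raw_mul (raw_mask n x) (raw_mask n y) n = raw_mul x y n.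
Proof.
move=> n0; apply: (@raw_transfer
  (fun k xs => raw_mul (raw_mask n (xs 0)) (raw_mask n (xs 1)))
  (fun k xs => raw_mul (xs 0) (xs 1)) n n0 _ _ _ k (seq2 x y)).
- by move=> ? ? ? ?; rewrite !(raw_nat, raw_mask_nat).
- by move=> ? ? ? ?; rewrite !raw_nat.
by move=> k' xs m m0 mn; rewrite !ghost_mul // !ghost_mask.
Qed.

Lemma raw_opp_mask n x : (0 < n)%N ->
  raw_opp (raw_mask n x) n = raw_opp x n.
Proof.
move=> n0; apply: (@raw_transfer
  (fun k xs => raw_opp (raw_mask n (xs 0))) (fun k xs => raw_opp (xs 0))
  n n0 _ _ _ k (seq2 x x)).
- by move=> ? ? ? ?; rewrite !(raw_nat, raw_mask_nat).
- by move=> ? ? ? ?; rewrite !raw_nat.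
by move=> k' xs m m0 mn; rewrite !ghost_opp // !ghost_mask.
Qed.

Lemma eq_raw_add n x x' y y' : (0 < n)%N ->
  (forall d, (d %| n)%N -> x d = x' d) -> (forall d, (d %| n)%N -> y d = y' d) ->
  raw_add x y n = raw_add x' y' n.
Proof.
move=> n0 ex ey.
by rewrite -(raw_add_mask x y n0) (eq_mask ex) (eq_mask ey) raw_add_mask.
Qed.

Lemma eq_raw_mul n x x' y y' : (0 < n)%N ->
  (forall d, (d %| n)%N -> x d = x' d) -> (forall d, (d %| n)%N -> y d = y' d) ->
  raw_mul x y n = raw_mul x' y' n.
Proof.
move=> n0 ex ey.
by rewrite -(raw_mul_mask x y n0) (eq_mask ex) (eq_mask ey) raw_mul_mask.
Qed.

Lemma eq_raw_opp n x x' : (0 < n)%N ->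
  (forall d, (d %| n)%N -> x d = x' d) -> raw_opp x n = raw_opp x' n.
Proof.
by move=> n0 ex; rewrite -(raw_opp_mask x n0) (eq_mask ex) raw_opp_mask.
Qed.

End Local.

(* A set of positive integers stable under division. *)
Record truncset := Truncset {
  tmem :> pred nat;
  truncset_gt0 : forall m, tmem m -> (0 < m)%N;
  truncset_dvd : forall m d, tmem m -> (d %| m)%N -> tmem d }.

Definition posnat : truncset.
Proof.
exists (fun m => 0 < m)%N => [//|m d m0 /dvdnP[q eq]].
by move: m0; rewrite eq muln_gt0 => /andP[].
Defined.

(* S/n = {s | n s \in S} *)
Section DivSet.
Variables (S : truncset) (n : nat).

Fact divset_gt0 m : S (n * m)%N -> (0 < m)%N.
Proof. by move/truncset_gt0; rewrite muln_gt0 => /andP[]. Qed.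

Fact divset_dvd m d : S (n * m)%N -> (d %| m)%N -> S (n * d)%N.
Proof. by move=> Sm dm; apply: truncset_dvd Sm _; rewrite dvdn_mul. Qed.

Definition divset : truncset := Truncset divset_gt0 divset_dvd.

End DivSet.

Definition witt (S : truncset) (k : comPzRingType) : Type := {n : nat | S n} -> k.

HB.instance Definition _ S k := Choice.copy (witt S k) ({n : nat | S n} -> k).

Section Witt.
Variables (S : truncset) (k : comPzRingType).
Implicit Types (x y z : witt S k) (u v : nat -> k) (i : {n : nat | S n}).

(* The nth coordinate, extended by 0 outside S. *)
Definition wcoef x n : k := if insub n is Some i then x i else 0.
Definition mkwitt u : witt S k := fun i => u (val i).

Lemma wcoefE x i : wcoef x (val i) = x i.
Proof. by rewrite /wcoef valK. Qed.

Lemma wcoef_mkwitt u n : S n -> wcoef (mkwitt u) n = u n.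
Proof. by move=> Sn; rewrite /wcoef insubT. Qed.

Lemma wcoefK x : mkwitt (wcoef x) = x.
Proof. by apply: funext => i; apply: wcoefE. Qed.

Lemma wcoef_out x n : ~~ S n -> wcoef x n = 0.
Proof. by move=> Sn; rewrite /wcoef insubN. Qed.

Lemma eq_mkwitt u v : (forall n, S n -> u n = v n) -> mkwitt u = mkwitt v.
Proof. by move=> e; apply: funext => i; apply/e/(valP i). Qed.

Let dvd_mk u n d : S n -> (d %| n)%N -> wcoef (mkwitt u) d = u d.
Proof. by move=> Sn dn; apply/wcoef_mkwitt/(truncset_dvd Sn dn). Qed.

Definition wadd x y := mkwitt (raw_add (wcoef x) (wcoef y)).
Definition wopp x := mkwitt (raw_opp (wcoef x)).
Definition wmul x y := mkwitt (raw_mul (wcoef x) (wcoef y)).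
Definition wzero := mkwitt (fun=> 0).
Definition wone := mkwitt (@raw_one k).

Lemma mkwittD u v : wadd (mkwitt u) (mkwitt v) = mkwitt (raw_add u v).
Proof.
apply: eq_mkwitt => n Sn.
by apply: eq_raw_add (truncset_gt0 Sn) _ _ => d dn; apply: dvd_mk Sn dn.
Qed.

Lemma mkwittM u v : wmul (mkwitt u) (mkwitt v) = mkwitt (raw_mul u v).
Proof.
apply: eq_mkwitt => n Sn.
by apply: eq_raw_mul (truncset_gt0 Sn) _ _ => d dn; apply: dvd_mk Sn dn.
Qed.

Lemma mkwittN u : wopp (mkwitt u) = mkwitt (raw_opp u).
Proof.
apply: eq_mkwitt => n Sn.
by apply: eq_raw_opp (truncset_gt0 Sn) _ => d dn; apply: dvd_mk Sn dn.
Qed.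

Fact waddA : associative wadd.
Proof.
move=> x y z; rewrite -[x]wcoefK -[y]wcoefK -[z]wcoefK !mkwittD.
by apply: eq_mkwitt => n /truncset_gt0; apply: raw_addA.
Qed.

Fact waddC : commutative wadd.
Proof. by move=> x y; apply: eq_mkwitt => n /truncset_gt0; apply: raw_addC. Qed.

Fact wadd0 : left_id wzero wadd.
Proof.
move=> x; rewrite -[x]wcoefK mkwittD.
by apply: eq_mkwitt => n /truncset_gt0; apply: raw_add0.
Qed.

Fact waddN : left_inverse wzero wopp wadd.
Proof.
move=> x; rewrite -[x]wcoefK mkwittN mkwittD.
by apply: eq_mkwitt => n /truncset_gt0; apply: raw_addN.
Qed.

HB.instance Definition _ :=
  GRing.isZmodule.Build (witt S k) waddA waddC wadd0 waddN.

Fact wmulA : associative wmul.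
Proof.
move=> x y z; rewrite -[x]wcoefK -[y]wcoefK -[z]wcoefK !mkwittM.
by apply: eq_mkwitt => n /truncset_gt0; apply: raw_mulA.
Qed.

Fact wmulC : commutative wmul.
Proof. by move=> x y; apply: eq_mkwitt => n /truncset_gt0; apply: raw_mulC. Qed.

Fact wmul1 : left_id wone wmul.
Proof.
move=> x; rewrite -[x]wcoefK mkwittM.
by apply: eq_mkwitt => n /truncset_gt0; apply: raw_mul1.
Qed.

Fact wmulDl : left_distributive wmul wadd.
Proof.
move=> x y z; rewrite -[x]wcoefK -[y]wcoefK -[z]wcoefK !(mkwittM, mkwittD).
by apply: eq_mkwitt => n /truncset_gt0; apply: raw_mulDl.
Qed.

HB.instance Definition _ :=
  GRing.Zmodule_isComPzRing.Build (witt S k) wmulA wmulC wmul1 wmulDl.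

Lemma mkD u v : mkwitt u + mkwitt v = mkwitt (raw_add u v).
Proof. exact: mkwittD. Qed.
Lemma mkN u : - mkwitt u = mkwitt (raw_opp u).
Proof. exact: mkwittN. Qed.
Lemma mkM u v : mkwitt u * mkwitt v = mkwitt (raw_mul u v).
Proof. exact: mkwittM. Qed.
Lemma mk0 : mkwitt (fun=> 0) = 0. Proof. by []. Qed.
Lemma mk1 : mkwitt (@raw_one k) = 1. Proof. by []. Qed.

Definition wghost n x : k := ghost n (wcoef x).

Let eq_wghost n u : S n -> wghost n (mkwitt u) = ghost n u.
Proof.
by move=> Sn; apply: eq_ghost (truncset_gt0 Sn) _ => d dn; apply: dvd_mk Sn dn.
Qed.

Lemma wghostD n x y : S n -> wghost n (x + y) = wghost n x + wghost n y.
Proof. by move=> Sn; rewrite eq_wghost // ghost_add // (truncset_gt0 Sn). Qed.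

Lemma wghostM n x y : S n -> wghost n (x * y) = wghost n x * wghost n y.
Proof. by move=> Sn; rewrite eq_wghost // ghost_mul // (truncset_gt0 Sn). Qed.

Lemma wghost1 n : S n -> wghost n 1 = 1.
Proof. by move=> Sn; rewrite eq_wghost // ghost1 // (truncset_gt0 Sn). Qed.

End Witt.

Arguments mkwitt S {k} u.

Section Functoriality.
Variables (S : truncset) (k l : comPzRingType) (h : {rmorphism k -> l}).

Definition wmap (x : witt S k) : witt S l := h \o x.

Lemma wcoef_map x : wcoef (wmap x) = h \o wcoef x.
Proof.
by apply: funext => n; rewrite /wcoef /=; case: insub => //=; rewrite rmorph0.
Qed.

Lemma wmap_mk u : wmap (mkwitt S u) = mkwitt S (h \o u).
Proof. by []. Qed.

Fact wmap_zmod : zmod_morphism wmap.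
Proof.
move=> x y; rewrite -[x]wcoefK -[y]wcoefK mkN mkD !wmap_mk mkN mkD.
by rewrite !raw_nat.
Qed.
HB.instance Definition _ := GRing.isZmodMorphism.Build _ _ wmap wmap_zmod.

Fact wmap_monoid : monoid_morphism wmap.
Proof.
split=> [|x y]; first by rewrite -mk1 wmap_mk raw_1_nat.
by rewrite -[x]wcoefK -[y]wcoefK mkM !wmap_mk mkM raw_mul_nat.
Qed.
HB.instance Definition _ := GRing.isMonoidMorphism.Build _ _ wmap wmap_monoid.

End Functoriality.

Notation bigwitt := (witt posnat).

Section Restriction.
Variables (S : truncset) (k : comPzRingType).

Definition wres (x : bigwitt k) : witt S k := mkwitt S (wcoef x).

Lemma wres_mk u : wres (mkwitt posnat u) = mkwitt S u.
Proof.
by apply: eq_mkwitt => n /truncset_gt0 n0; rewrite wcoef_mkwitt.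
Qed.

Fact wres_zmod : zmod_morphism wres.
Proof.
by move=> x y; rewrite -[x]wcoefK -[y]wcoefK mkN mkD !wres_mk mkN mkD.
Qed.
HB.instance Definition _ := GRing.isZmodMorphism.Build _ _ wres wres_zmod.

Fact wres_monoid : monoid_morphism wres.
Proof.
split=> [|x y]; first by rewrite -mk1 wres_mk.
by rewrite -[x]wcoefK -[y]wcoefK mkM !wres_mk mkM.
Qed.
HB.instance Definition _ := GRing.isMonoidMorphism.Build _ _ wres wres_monoid.

Definition wscale (c : bigwitt k) (x : witt S k) : witt S k := wres c * x.

Fact wscaleA c d x : wscale c (wscale d x) = wscale (c * d) x.
Proof. by rewrite /wscale mulrA rmorphM. Qed.
Fact wscale1 : left_id 1 wscale.
Proof. by move=> x; rewrite /wscale rmorph1 mul1r. Qed.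
Fact wscaleDr : right_distributive wscale +%R.
Proof. by move=> c x y; rewrite /wscale mulrDr. Qed.
Fact wscaleDl x : {morph wscale^~ x : c d / c + d}.
Proof. by move=> c d; rewrite /wscale rmorphD mulrDl. Qed.

HB.instance Definition _ := GRing.Zmodule_isLmodule.Build (bigwitt k)
  (witt S k) wscaleA wscale1 wscaleDr wscaleDl.

End Restriction.

Section Verschiebung.
Variables (S : truncset) (k : comPzRingType).

Definition wV n (x : witt (divset S n) k) : witt S k :=
  mkwitt S (raw_V n (wcoef x)).

Arguments wV : clear implicits.
Fact wV0 x : wV 0 x = 0.
Proof.
apply: eq_mkwitt => m /truncset_gt0; rewrite /raw_V dvd0n.
by case: m.
Qed.

Lemma wV_mk n u : wV n (mkwitt (divset S n) u) = mkwitt S (raw_V n u).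
Proof.
apply: eq_mkwitt => m Sm; rewrite /raw_V; case: ifP => // /dvdnP[q eq].
rewrite wcoef_mkwitt //= mulnC divnK //; first by rewrite eq dvdn_mull.
Qed.

Lemma wVD n (x y : witt (divset S n) k) : wV n (x + y) = wV n x + wV n y.
Proof.
case: n x y => [|n] x y; first by rewrite !wV0 addr0.
rewrite -[x]wcoefK -[y]wcoefK mkD !wV_mk mkD.
by apply: eq_mkwitt => m /truncset_gt0; apply: raw_VD.
Qed.

Lemma wV_zero n : wV n 0 = 0.
Proof.
by rewrite -!mk0 wV_mk; apply: eq_mkwitt => m _; rewrite /raw_V if_same.
Qed.

(* The projection formula c V_n(x) = V_n(F_n(c) x). *)
Lemma wVZ n (c : bigwitt k) (x : witt (divset S n) k) :
  exists y : witt (divset S n) k, c *: wV n x = wV n y.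
Proof.
case: n x => [|n] x; first by exists 0; rewrite !wV0 scaler0.
exists (mkwitt _ (raw_mul (raw_F n.+1 (wcoef c)) (wcoef x))).
rewrite wV_mk -[LHS]/(mkwitt S _ * mkwitt S _) mkM.
by apply: eq_mkwitt => m /truncset_gt0; apply: raw_VM.
Qed.

Variables a b : nat.

(* V_a W_(S/a)(k) + V_b W_(S/b)(k) *)
Definition VaVb : {pred witt S k} := fun z =>
  `[< exists (x : witt (divset S a) k) (y : witt (divset S b) k),
        z = wV a x + wV b y >].

Fact VaVb_submod : submod_closed VaVb.
Proof.
split=> [|c u v /asboolP[x [y ->]] /asboolP[x' [y' ->]]]; apply/asboolP.
  by exists 0, 0; rewrite !wV_zero addr0.
have [x1 ex] := wVZ c x; have [y1 ey] := wVZ c y.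
by exists (x1 + x'), (y1 + y'); rewrite !wVD scalerDr ex ey addrACA.
Qed.

End Verschiebung.
Arguments wV {S k} n x.
Arguments VaVb {S k} a b.
Arguments VaVb_submod S k a b : clear implicits.

(* The quotient of the module M by the submodule N. *)
Section QuotientModule.
Variables (R : pzRingType) (M : lmodType R) (N : {pred M}).
Hypothesis N_submod : submod_closed N.

Definition quotmod_ker : zmodClosed M :=
  HB.pack_for (zmodClosed M) (N : M -> bool)
    (GRing.isZmodClosed.Build M N (GRing.submod_closedB N_submod)).
Definition quotmod : Type := Quotient.quot quotmod_ker.
HB.instance Definition _ := GRing.Zmodule.on quotmod.

Local Open Scope quotient_scope.
Definition quotmod_pi (x : M) : quotmod := \pi_(Quotient.quot quotmod_ker) x.
Definition quotmod_scale (c : R) (x : quotmod) : quotmod :=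
  quotmod_pi (c *: repr (x : Quotient.quot quotmod_ker)).

Lemma quotmod_piP (x : quotmod) : exists y, x = quotmod_pi y.
Proof. by exists (repr (x : Quotient.quot quotmod_ker)); rewrite /quotmod_pi reprK. Qed.

Lemma quotmod_pi_eq x y : (quotmod_pi x = quotmod_pi y) <-> (x - y \in N).
Proof.
rewrite -[x - y \in N]/(x - y \in quotmod_ker) Quotient.idealrBE.
by split=> [e|/eqP//]; apply/eqP. Qed.

Lemma quotmod_piZ c x : quotmod_scale c (quotmod_pi x) = quotmod_pi (c *: x).
Proof.
apply/quotmod_pi_eq; rewrite -scalerBr -[_ *: _]addr0.
apply: N_submod.2; last exact: N_submod.1.
by rewrite -[_ \in N]/(_ \in quotmod_ker) Quotient.idealrBE reprK.
Qed.

Lemma quotmod_piD x y : quotmod_pi (x + y) = quotmod_pi x + quotmod_pi y.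
Proof. exact: (Quotient.pi_add quotmod_ker). Qed.

Fact quotmod_scaleA c d x :
  quotmod_scale c (quotmod_scale d x) = quotmod_scale (c * d) x.
Proof. by have [y ->] := quotmod_piP x; rewrite !quotmod_piZ scalerA. Qed.
Fact quotmod_scale1 : left_id 1 quotmod_scale.
Proof. by move=> x; have [y ->] := quotmod_piP x; rewrite quotmod_piZ scale1r. Qed.
Fact quotmod_scaleDr : right_distributive quotmod_scale +%R.
Proof.
move=> c x y; have [x' ->] := quotmod_piP x; have [y' ->] := quotmod_piP y.
by rewrite -quotmod_piD !quotmod_piZ scalerDr quotmod_piD.
Qed.
Fact quotmod_scaleDl x : {morph quotmod_scale^~ x : c d / c + d}.
Proof.
move=> c d; have [y ->] := quotmod_piP x.
by rewrite !quotmod_piZ scalerDl quotmod_piD.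
Qed.
HB.instance Definition _ := GRing.Zmodule_isLmodule.Build R quotmod
  quotmod_scaleA quotmod_scale1 quotmod_scaleDr quotmod_scaleDl.

End QuotientModule.

(* l(a,b,m): the bound i, j <= m is automatic for a, b > 0. *)
Definition nsol (a b m : nat) : nat :=
  #|[set ij : 'I_m.+1 * 'I_m.+1 |
      [&& 0 < ij.1, 0 < ij.2 & a * ij.1 + b * ij.2 == m]%N]|.

Lemma leq_nsol a b m d : (0 < m)%N -> (d %| m)%N -> (nsol a b d <= nsol a b m)%N.
Proof.
move=> m0 /dvdnP[q eq].
have q0 : (0 < q)%N by move: m0; rewrite eq muln_gt0 => /andP[].
pose f (ij : 'I_d.+1 * 'I_d.+1) : 'I_m.+1 * 'I_m.+1 :=
  (inord (q * ij.1), inord (q * ij.2)).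
have lt (i : 'I_d.+1) : (q * i < m.+1)%N by rewrite ltnS eq leq_mul2l -ltnS ltn_ord orbT.
rewrite /nsol -(card_imset _ (f := f)); last first.
  move=> [i j] [i' j'] [] /(congr1 val) /= e1 /(congr1 val) /= e2.
  move: e1 e2; rewrite !inordK // => /eqP + /eqP; rewrite !eqn_pmul2l //.
  by move=> /eqP/val_inj-> /eqP/val_inj->.
apply/subset_leq_card/subsetP => _ /imsetP[[i j] + ->].
rewrite !inE /= !inordK // !muln_gt0 q0 /= => /and3P[-> -> /eqP e] /=.
by rewrite !(mulnCA _ q) -mulnDr e eq.
Qed.

Section Sabr.
Variables a b r : nat.

Fact Sabr_gt0 m : (0 < m)%N && (nsol a b m <= r)%N -> (0 < m)%N.
Proof. by case/andP. Qed.

Fact Sabr_dvd m d : (0 < m)%N && (nsol a b m <= r)%N -> (d %| m)%N ->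
  (0 < d)%N && (nsol a b d <= r)%N.
Proof.
move=> /andP[m0 mr] dm; rewrite (dvdn_gt0 m0 dm).
exact: leq_trans (leq_nsol _ _ m0 dm) mr.
Qed.

Definition Sabr : truncset := Truncset Sabr_gt0 Sabr_dvd.

End Sabr.

Section Length.
Variables (R : pzRingType) (M : lmodType R).

Definition strict_chain (n : nat) (P : nat -> {pred M}) : Prop :=
  (forall i, (i <= n)%N -> submod_closed (P i)) /\
  (forall i, (i < n)%N ->
     {subset P i <= P i.+1} /\ exists2 x, x \in P i.+1 & x \notin P i).

(* The length of M is the supremum of the lengths of its strict chains of
   submodules. *)
Definition has_length (n : nat) : Prop :=
  (exists P, strict_chain n P) /\
  (forall m P, strict_chain m P -> (m <= n)%N).

(* For submodules P <= Q of M: Q/P is isomorphic to k, on which R acts through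
   the ring morphism w. *)
Definition subquot_iso (k : comPzRingType) (w : R -> k) (P Q : {pred M}) : Prop :=
  exists g : M -> k,
    [/\ {in Q &, forall x y, g (x + y) = g x + g y},
        forall c, {in Q, forall x, g (c *: x) = w c * g x},
        forall y, exists2 x, x \in Q & g x = y
      & {in Q, forall x, (g x = 0) <-> (x \in P)}].

End Length.

(* M has a finite filtration by W(k)-submodules whose successive quotients are
   k, with W(k) acting through w_m, for m running through ms. *)
Definition ghost_filtration (k : comPzRingType) (M : lmodType (bigwitt k))
    (ms : seq nat) : Prop :=
  exists F : nat -> {pred M},
    [/\ forall i, (i <= size ms)%N -> submod_closed (F i),
        F 0%N =i pred1 0,
        F (size ms) =i predT,
        forall i, (i < size ms)%N -> {subset F i <= F i.+1}
      & forall i, (i < size ms)%N ->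
          subquot_iso (wghost (nth 0%N ms i)) (F i) (F i.+1)].

(* Fields of characteristic 0 are perfect. *)
Definition perfect_field (k : comPzRingType) : Prop :=
  [/\ 1 != 0 :> k,
      forall x : k, x != 0 -> exists y, x * y = 1
    & forall p, prime p -> p%:R = 0 :> k -> forall x : k, exists y, y ^+ p = x].

(* W_S(k)/(V_a W_(S/a)(k) + V_b W_(S/b)(k)) as a W(k)-module. *)
Definition cuspquot (S : truncset) (k : comPzRingType) (a b : nat) :
    lmodType (bigwitt k) :=
  quotmod (VaVb_submod S k a b).

Lemma cuspquot_scale (S : truncset) (k : comPzRingType) (a b : nat)
    (c : bigwitt k) (x : witt S k) :
  c *: (quotmod_pi (VaVb_submod S k a b) x : cuspquot S k a b) =
  quotmod_pi (VaVb_submod S k a b) (@wres S k c * x).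
Proof. exact: quotmod_piZ. Qed.

(* Main.v *)
(* Vectors with disjoint supports add coordinatewise, so V_a W + V_b W consists
   of the vectors whose coordinates vanish at all m in S divisible by neither a
   nor b, and the quotient is a ring of Witt vectors on the set T of those m.
   Filter it by the vanishing of the coordinates at small m: since
   c V_m [y] = V_m (F_m(c) [y]), W(k) acts on the piece of index m through w_m,
   and w_m is surjective when k is a perfect field, so that the pieces are simple.

   To count T, write m + ab = ai + bs + abq with 0 < i < b and 0 < s < a.  Then
   l(a,b,m) = q, so m runs through q <= r with the condition ai + bs + abq > ab,
   which is void for q > 0 and holds for exactly half of the pairs (i,s) when
   q = 0, by the symmetry (i,s) |-> (b - i, a - s). *)
Require Import Defs.
From mathcomp Require Import all_boot all_order all_algebra.
From mathcomp.classical Require Import boolp.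
From mathcomp Require Import zify.

Set Implicit Arguments.
Unset Strict Implicit.
Unset Printing Implicit Defensive.

Import Order.TTheory GRing.Theory Num.Theory.
Local Open Scope ring_scope.

(** * The elements of [Sabr a b r] divisible by neither [a] nor [b] *)

Section Counting.
Local Open Scope nat_scope.
Variables a b : nat.
Hypotheses (a1 : 1 < a) (b1 : 1 < b) (cab : coprime a b).

Let a0 : 0 < a. Proof. exact: ltnW. Qed.
Let b0 : 0 < b. Proof. exact: ltnW. Qed.

Lemma eqn_mod_coprimel (c d x y : nat) :
  coprime c d -> c * x = c * y %[mod d] -> x = y %[mod d].
Proof.
move=> cd; wlog le : x y / x <= y => [W e|/esym/eqP].
  by case/orP: (leq_total x y) => le; [|apply/esym]; apply: W.
rewrite eqn_mod_dvd ?leq_mul2l ?le ?orbT // -mulnBr Gauss_dvdr 1?coprime_sym //.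
by rewrite -eqn_mod_dvd // => /eqP.
Qed.

Lemma solve_mod_coprime (c d m : nat) : 0 < c -> 0 < d -> coprime c d ->
  exists2 x, x < d & c * x = m %[mod d].
Proof.
move=> c0 d0 /(coprimeP _ c0)[[u v] /= e].
exists (m * u %% d); first by rewrite ltn_mod.
rewrite modnMmr mulnCA [c * u]mulnC.
have -> : u * c = v * d + 1 by lia.
by rewrite mulnDr muln1 mulnA modnMDl.
Qed.

(* The solutions are (i + b t, s + a (q - 1 - t)) for 0 <= t < q. *)
Lemma nsol_residues m i s q : 0 < i < b -> 0 < s < a ->
  m + a * b = a * i + b * s + a * b * q -> nsol a b m = q.
Proof.
move=> /andP[i0 ib] /andP[s0 sa] e.
have mlt t u : t + u + 1 = q -> m = a * (i + b * t) + b * (s + a * u).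
  by move=> tu; move: e; rewrite -tu; lia.
have lem x y : a * x + b * y = m -> (x < m.+1) && (y < m.+1).
  move=> <-; rewrite !ltnS; apply/andP; split.
    by rewrite (leq_trans (leq_pmull x a0)) ?leq_addr.
  by rewrite (leq_trans (leq_pmull y b0)) ?leq_addl.
pose f (t : 'I_q) : 'I_m.+1 * 'I_m.+1 :=
  (inord (i + b * t), inord (s + a * (q - t.+1))).
have fE t : ((f t).1 = i + b * t :> nat) * ((f t).2 = s + a * (q - t.+1) :> nat).
  have /esym/lem/andP[l1 l2] : m = a * (i + b * t) + b * (s + a * (q - t.+1)).
    by apply: mlt; rewrite addnAC addn1 subnKC.
  by rewrite !inordK.
rewrite /nsol -[RHS]card_ord -cardsT -(card_imset _ (f := f)); last first.
  move=> t t' /(congr1 (fun p => nat_of_ord p.1)); rewrite !fE => /addnI/eqP.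
  by rewrite eqn_pmul2l // => /eqP/val_inj.
apply: eq_card => -[x y]; rewrite inE /=; apply/idP/imsetP => [|[t _ et]].
  move=> /and3P[x0 y0 /eqP exy].
  (* Modulo [b], both [a * x] and [a * i] are congruent to [m], and [a] cancels. *)
  have ex : x = i %[mod b].
    apply: (@eqn_mod_coprimel a) => //.
    rewrite -(modnMDl (y + a) (a * x)) -(modnMDl (s + a * q) (a * i)).
    by congr (_ %% _); lia.
  have ey : y = s %[mod a].
    apply: (@eqn_mod_coprimel b); first by rewrite coprime_sym.
    rewrite -(modnMDl (x + b) (b * y)) -(modnMDl (i + b * q) (b * s)).
    by congr (_ %% _); lia.
  rewrite (modn_small ib) in ex; rewrite (modn_small sa) in ey.
  have dx := divn_eq x b; have dy := divn_eq y a; rewrite ex in dx; rewrite ey in dy.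
  set t := x %/ b in dx; set u := y %/ a in dy.
  have tu : t + u + 1 = q.
    apply/eqP; rewrite -(eqn_pmul2l (_ : 0 < a * b)) ?muln_gt0 ?a0 //.
    by apply/eqP; rewrite dx dy in exy; lia.
  have tq : t < q by lia.
  exists (Ordinal tq) => //; congr (_, _); apply: val_inj; rewrite /= inordK.
  - by rewrite dx; lia.
  - by apply: leq_trans (ltn_ord x); rewrite dx; lia.
  - by rewrite dy (_ : u = q - t.+1); lia.
  - by apply: leq_trans (ltn_ord y); rewrite dy (_ : u = q - t.+1); lia.
have e1 := (fE t).1; have e2 := (fE t).2; rewrite -et /= in e1 e2.
rewrite e1 e2 !addn_gt0 i0 s0 /=; apply/eqP/esym/mlt.
by rewrite addnAC addn1 subnKC.
Qed.

(** Modulo [a] the equation reads m = b s, with [b] invertible and 0 < s < a; modulo [b] it reads m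
    = a i. *)
Lemma residues_ndvd m i s q : 0 < i < b -> 0 < s < a ->
  m + a * b = a * i + b * s + a * b * q -> ~~ (a %| m) && ~~ (b %| m).
Proof.
move=> /andP[i0 ib] /andP[s0 sa] e; apply/andP; split; apply/negP => dm.
  have : a %| m + a * b by rewrite dvdn_addl // dvdn_mulr.
  rewrite e -mulnA addnAC -mulnDr (dvdn_addr _ (dvdn_mulr _ (dvdnn a))) Gauss_dvdr //.
  by move/dvdn_leq => /(_ s0); rewrite leqNgt sa.
have : b %| m + a * b by rewrite dvdn_addl // dvdn_mull.
rewrite e [a * b]mulnC -mulnA -addnA -mulnDr (dvdn_addl _ (dvdn_mulr _ (dvdnn b))).
rewrite Gauss_dvdr 1?coprime_sym //.
by move/dvdn_leq => /(_ i0); rewrite leqNgt ib.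
Qed.

(** Solving a i = m modulo [b] and b s = m modulo [a] gives a i + b s = m modulo a b, by the Chinese
    remainder theorem. Since a i + b s < 2 a b, the shift of [m] by a b makes the quotient [q]
    nonnegative. *)
Lemma residues_ex m : 0 < m -> ~~ (a %| m) -> ~~ (b %| m) ->
  exists i s q, [/\ 0 < i < b, 0 < s < a
    & m + a * b = a * i + b * s + a * b * q].
Proof.
move=> m0 am bm.
have [i ib ei] := solve_mod_coprime m a0 b0 cab.
have [s sa es] : exists2 x, x < a & b * x = m %[mod a].
  by apply: solve_mod_coprime => //; rewrite coprime_sym.
have i0 : 0 < i.
  by rewrite lt0n; apply: contra bm => /eqP i0; rewrite /dvdn -ei i0 muln0 mod0n.
have s0 : 0 < s.
  by rewrite lt0n; apply: contra am => /eqP s0; rewrite /dvdn -es s0 muln0 mod0n.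
have emod : m + a * b = a * i + b * s %[mod a * b].
  apply/eqP; rewrite chinese_remainder //; apply/andP; split; apply/eqP.
    by rewrite [m + _]addnC ![a * _]mulnC !modnMDl es.
  by rewrite addnC modnMDl [b * s]mulnC addnC modnMDl ei.
have ub : a * i + b * s < m + a * b + a * b.
  have l1 : a * i < a * b by rewrite ltn_pmul2l.
  have l2 : b * s < a * b by rewrite [a * b]mulnC ltn_pmul2l.
  by clear -l1 l2; lia.
have le : a * i + b * s <= m + a * b.
  rewrite leqNgt; apply/negP => lt.
  move/eqP: emod; rewrite eq_sym eqn_mod_dvd; last exact: ltnW.
  by move/dvdn_leq; rewrite subn_gt0 => /(_ lt); rewrite leqNgt => /negP; apply; clear -ub lt; lia.
move/eqP: emod; rewrite eqn_mod_dvd // => /dvdnP[q eq].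
exists i, s, q; split; [by rewrite i0 | by rewrite s0|].
by rewrite -(subnKC le) eq [q * _]mulnC.
Qed.

Lemma residues_inj i s q i' s' q' : i < b -> s < a -> i' < b -> s' < a ->
  a * i + b * s + a * b * q = a * i' + b * s' + a * b * q' ->
  [/\ i = i', s = s' & q = q'].
Proof.
move=> ib sa ib' sa' e.
have ei : i = i'.
  rewrite -(modn_small ib) -(modn_small ib'); apply: (@eqn_mod_coprimel a) => //.
  by rewrite -(modnMDl (s + a * q)) -[RHS](modnMDl (s' + a * q')); congr (_ %% _); lia.
have es : s = s'.
  rewrite -(modn_small sa) -(modn_small sa').
  apply: (@eqn_mod_coprimel b); first by rewrite coprime_sym.
  by rewrite -(modnMDl (i + b * q)) -[RHS](modnMDl (i' + b * q')); congr (_ %% _); lia.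
split=> //; apply/eqP; rewrite -(eqn_pmul2l (_ : 0 < a * b)) ?muln_gt0 ?a0 //.
by apply/eqP; move: e; rewrite ei es => /addnI.
Qed.

Definition box : {set 'I_b * 'I_a} := [set p : 'I_b * 'I_a | (0 < p.1) && (0 < p.2)].
(** The residue pairs (i, s) for which q = 0 yields a positive m. *)
Definition upper_box := [set p in box | a * b < a * p.1 + b * p.2].

Lemma card_box : #|box| = (b - 1) * (a - 1).
Proof.
have cI n : 0 < n -> #|[set i : 'I_n | 0 < i]| = n - 1.
  case: n => // n _; rewrite subn1 /=.
  rewrite (_ : [set i : 'I_n.+1 | 0 < i] = [set~ ord0]).
    by rewrite cardsC1 card_ord.
  by apply/setP => i; rewrite !inE lt0n.
rewrite -!cI // -cardsX; apply: eq_card => -[i s].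
by rewrite !inE.
Qed.

Lemma card_upper_box : (#|upper_box|).*2 = (b - 1) * (a - 1).
Proof.
rewrite -card_box -addnn -(cardsID upper_box box); congr (_ + _).
  by apply: eq_card => p; rewrite !inE; case: (0 < p.1); case: (0 < p.2).
pose f (p : 'I_b * 'I_a) : 'I_b * 'I_a :=
  (insubd p.1 (b - p.1), insubd p.2 (a - p.2)).
have fE p : p \in box -> ((f p).1 = b - p.1 :> nat) * ((f p).2 = a - p.2 :> nat).
  by rewrite inE => /andP[i0 s0]; rewrite !val_insubd !ltn_subrL i0 s0 a0 b0.
have fbox p : p \in box -> f p \in box.
  by move=> pb; rewrite inE !fE // !subn_gt0 !ltn_ord.
have fK : {in box, involutive f}.
  move=> p pb; have pfb := fbox p pb.
  rewrite [LHS]surjective_pairing [RHS]surjective_pairing; congr (_, _).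
    by apply: ord_inj; rewrite !fE // subKn // ltnW.
  by apply: ord_inj; rewrite !fE // subKn // ltnW.
rewrite -(@card_in_imset _ _ f); last first.
  move=> p p' /setIdP[pb _] /setIdP[pb' _] ef.
  by rewrite -(fK p pb) ef fK.
apply: eq_card => p; apply/imsetP/idP => [[p' /setIdP[pb lt] ->]|].
  rewrite in_setD fbox // andbT /upper_box in_set fbox // andTb -leqNgt !fE //.
  have := ltn_ord p'.1; have := ltn_ord p'.2 => l2 l1.
  rewrite !mulnBr [b * a]mulnC; have : a * p'.1 <= a * b by rewrite leq_mul2l ltnW ?orbT.
  have : b * p'.2 <= a * b by rewrite mulnC leq_mul2r ltnW ?orbT.
  by clear -lt; lia.
rewrite in_setD => /andP[np pb]; exists (f p); last by rewrite fK.
rewrite in_set fbox // andTb !fE //; move: np; rewrite in_set pb andTb -leqNgt => le.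
have l1 := ltn_ord p.1; have l2 := ltn_ord p.2.
have m1 : a * p.1 <= a * b by rewrite leq_mul2l ltnW ?orbT.
have m2 : b * p.2 <= a * b by rewrite mulnC leq_mul2r ltnW ?orbT.
(* No pair lies on the boundary between the two halves: [b] would divide [p.1], which lies strictly
   between 0 and [b]. *)
have ne : a * p.1 + b * p.2 != a * b.
  apply/eqP => e; move: pb; rewrite inE => /andP[p10 p20].
  have : b %| a * p.1 + b * p.2 by rewrite e dvdn_mull.
  rewrite (dvdn_addl _ (dvdn_mulr _ (dvdnn b))) Gauss_dvdr 1?coprime_sym // => /(dvdn_leq p10).
  by rewrite leqNgt l1.
by rewrite !mulnBr [b * a]mulnC; lia.
Qed.

(** The list is decreasing so that each of its tails is stable under division, as the filtration of
    the quotient requires. *)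
Lemma Sabr_coprime_part r : exists ms : seq nat,
  [/\ sorted gtn ms,
      forall m, (m \in ms) = [&& Sabr a b r m, ~~ (a %| m) & ~~ (b %| m)]
    & size ms = ((2 * r + 1) * (a - 1) * (b - 1)) %/ 2].
Proof.
pose val3 (t : 'I_b * 'I_a * 'I_r.+1) :=
  a * t.1.1 + b * t.1.2 + a * b * t.2.
(* The inequality in [A] says that m = [val3 t - a * b] is positive. *)
pose A := [set t : 'I_b * 'I_a * 'I_r.+1 |
  (t.1 \in box) && (a * b < val3 t)].
pose f t := val3 t - a * b.
pose ms := sort geq [seq f t | t in A].
have fE t : t \in A -> f t + a * b = val3 t.
  by rewrite inE => /andP[_ /ltnW/subnK].
have ums : uniq ms.
  rewrite sort_uniq map_inj_in_uniq ?enum_uniq // => t t'.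
  rewrite !mem_enum => tA tA' ef.
  have : val3 t = val3 t' by rewrite -!fE ?ef.
  case/residues_inj; rewrite ?ltn_ord // => e1 e2 e3.
  case: t t' {tA tA' ef} e1 e2 e3 => -[i s] q [[i' s'] q'] /=.
  by move=> /val_inj-> /val_inj-> /val_inj->.
exists ms; split.
- rewrite gtn_sorted_uniq_geq ums; apply: sort_sorted => m n; exact: leq_total.
- move=> m; rewrite mem_sort; apply/imageP/idP => [[t tA ->]|].
    have e := fE t tA; move: tA; rewrite !inE => /andP[/andP[i0 s0] lt].
    have ib : 0 < t.1.1 < b by rewrite i0 ltn_ord.
    have sa : 0 < t.1.2 < a by rewrite s0 ltn_ord.
    rewrite /Sabr /= (residues_ndvd ib sa e) (nsol_residues ib sa e).
    by rewrite subn_gt0 lt -ltnS ltn_ord.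
  case/and3P=> /andP[m0 mr] am bm.
  have [i [s [q [ib sa e]]]] := residues_ex m0 am bm.
  have qr : q < r.+1 by move: mr; rewrite (nsol_residues ib sa e).
  have /andP[i0 ib'] := ib; have /andP[s0 sa'] := sa.
  exists (Ordinal ib', Ordinal sa', Ordinal qr); last by rewrite /f /val3 /= -e addnK.
  by rewrite !inE /= i0 s0 /val3 /= -e -addn1 addnC leq_add2r.
rewrite size_sort size_map -cardE.
(* The layer q = 0 keeps only the upper half of the box; each of the [r] layers q > 0 keeps all of
   it. *)
have -> : #|A| = #|upper_box| + r * #|box|.
  pose B := [set t : 'I_b * 'I_a * 'I_r.+1 | t.2 == ord0].
  rewrite -(cardsID B); congr (_ + _).
    rewrite -(@card_imset _ _ (fun p : 'I_b * 'I_a => (p, ord0 : 'I_r.+1))); last by move=> ? ? [].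
    apply: eq_card => -[p q]; rewrite !inE; apply/idP/imsetP => [|[p' + [-> ->]]].
      move=> /andP[/andP[pb lt] /eqP /= eq]; rewrite eq /= in lt *.
      by exists p => //; rewrite !inE pb; move: lt; rewrite /val3 /= muln0 addn0.
    by rewrite !inE /val3 /= muln0 addn0 andbT.
  rewrite mulnC -[r in RHS]card_ord -cardsT -cardsX.
  rewrite -(@card_imset _ _ (fun t : 'I_b * 'I_a * 'I_r => (t.1, lift ord0 t.2)));
    last by move=> [p q] [p' q'] /(congr1 (fun t => (t.1, nat_of_ord t.2)))[-> /val_inj->].
  apply: eq_card => -[p q]; rewrite !inE /=; apply/idP/imsetP => [|[[p' q'] + [-> ->]]].
    case: (unliftP ord0 q) => [q' ->|-> //] /andP[_ /andP[pb _]].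
    by exists (p, q'); rewrite ?inE ?pb.
  rewrite !inE /= andbT => /andP[i0 s0]; rewrite i0 s0 /= /val3 /= /bump leq0n.
  nia.
apply/eqP; rewrite -(eqn_pmul2r (_ : 0 < 2)) //; apply/eqP.
have cu := card_upper_box; have cb := card_box.
(* The product is even, so the integer division by 2 is exact. *)
have -> : (2 * r + 1) * (a - 1) * (b - 1) = (#|upper_box| + r * #|box|) * 2.
  by rewrite cb; lia.
by rewrite mulnK.
Qed.

End Counting.

(** * Length of a module filtered with simple pieces *)

Section LengthOfFiltration.
Variables (R : pzRingType) (M : lmodType R) (k : comPzRingType).
Variables (n : nat) (ws : nat -> R -> k) (F : nat -> {pred M}).
Hypotheses (Fsub : forall i, (i <= n)%N -> submod_closed (F i))
  (F0 : F 0%N =i pred1 0) (Fn : F n =i predT)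
  (FS : forall i, (i < n)%N -> {subset F i <= F i.+1})
  (Fiso : forall i, (i < n)%N -> subquot_iso (ws i) (F i) (F i.+1))
  (k_nz : 1 != 0 :> k)
  (ws_simple : forall i (y z : k), (i < n)%N -> y != 0 ->
     exists c, ws i c * y = z).

Lemma filtration_strict_chain : strict_chain n F.
Proof.
split=> // i lin; split; first exact: FS.
have [g [_ _ gsurj gker]] := Fiso lin.
have [x xF gx] := gsurj 1; exists x => //.
by apply/negP => /(gker x xF) g0; move: k_nz; rewrite -gx g0 eqxx.
Qed.

(** The pieces F(i+1)/F(i) in which the intersection of [P] with F(i+1) has nonzero image. The
    cardinal of this set plays the role of the length of [P]. *)
Definition new_at (P : {pred M}) : {set 'I_n} :=
  [set i : 'I_n | `[< exists x, [/\ x \in P, x \in F i.+1 & x \notin F i] >]].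

Lemma new_atS (P Q : {pred M}) : {subset P <= Q} -> new_at P \subset new_at Q.
Proof.
move=> PQ; apply/subsetP => i; rewrite !inE => /asboolP[x [xP xS xi]].
by apply/asboolP; exists x; split=> //; apply: PQ.
Qed.

(* Simplicity of the pieces: an x in Q that is new at i is corrected by a
   multiple of some y in P new at i, which pushes it down to F i. *)
Lemma new_at_sub (P Q : {pred M}) : submod_closed P -> submod_closed Q ->
  {subset P <= Q} -> new_at Q \subset new_at P -> {subset Q <= P}.
Proof.
move=> subP subQ PQ sQP.
suff QF i : (i <= n)%N -> forall x, x \in Q -> x \in F i -> x \in P.
  by move=> x xQ; apply: (QF n) => //; rewrite Fn.
elim: i => [_ x _|i IH lin x xQ xF].
  by rewrite F0 => /eqP->; case: subP.
have [xi|xi] := boolP (x \in F i); first exact: (IH (ltnW lin)).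
have /(subsetP sQP) : Ordinal lin \in new_at Q by rewrite inE; apply/asboolP; exists x.
rewrite inE => /asboolP[y [yP yF yi]].
have [g [gD gZ _ gker]] := Fiso lin.
have gy : g y != 0 by apply: contra yi => /eqP/(gker y yF).
have [c ec] := ws_simple (- g x) lin gy.
have subF := Fsub lin.
have zP : c *: y + x \in F i.+1 by case: subF => _; apply.
have cyF : c *: y \in F i.+1 by case: subF => s0 s1; rewrite -[_ *: _]addr0 s1.
have zF : c *: y + x \in F i by apply/(gker _ zP); rewrite gD // gZ // ec addNr.
have zQ : c *: y + x \in Q by case: subQ => _; apply=> //; apply: PQ.
have zP' := IH (ltnW lin) _ zQ zF.
by rewrite -[x](addKr (c *: y)) -scaleNr; case: subP => _; apply.
Qed.

(** By [new_at_sub], each strict inclusion of submodules strictly enlarges [new_at], a subset of an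
    [n]-element set. *)
Lemma has_length_filtration : has_length M n.
Proof.
split=> [|m P [subP ltP]]; first by exists F; apply: filtration_strict_chain.
suff card_new j : (j <= m)%N -> (j <= #|new_at (P j)|)%N.
  by apply: leq_trans (card_new m _) _ => //; rewrite -[X in (_ <= X)%N]card_ord max_card.
elim: j => // j IH jm; apply: leq_ltn_trans (IH (ltnW jm)) _.
have [PS [x xPS xP]] := ltP j jm.
apply: proper_card; rewrite properE new_atS //=.
apply: contra xP => /(new_at_sub (subP _ (ltnW jm)) (subP _ jm) PS); exact.
Qed.

End LengthOfFiltration.

(** * Vectors with restricted support *)

Section RawSupport.
Implicit Types k : comPzRingType.

Definition raw_only k (A : pred nat) (x : nat -> k) d := if A d then x d else 0.

Lemma raw_only_nat (k l : comPzRingType) (h : {rmorphism k -> l}) A x :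
  h \o raw_only A x = raw_only A (h \o x).
Proof.
by apply: funext => d; rewrite /= /raw_only; case: ifP; rewrite ?rmorph0.
Qed.

(* Ghost components are sums over the coordinates, so vectors with disjoint
   supports add coordinatewise. *)
Lemma raw_add_onlyC k A (x : nat -> k) n : (0 < n)%N ->
  raw_add (raw_only A x) (raw_only (predC A) x) n = x n.
Proof.
move=> n0; apply: (@raw_transfer
  (fun k xs => raw_add (raw_only A (xs 0%N)) (raw_only (predC A) (xs 0%N)))
  (fun k xs => xs 0%N) n n0 _ _ _ k (fun=> x)) => //.
  by move=> k' l h xs; rewrite raw_add_nat !raw_only_nat.
move=> k' xs m m0 _; rewrite ghost_add // /ghost -big_split /=.
rewrite big_seq [RHS]big_seq; apply: eq_bigr => d; rewrite -dvdn_divisors // => dm.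
by rewrite /raw_only /=; case: (A d); rewrite expr0_div // mul0rn ?addr0 ?add0r.
Qed.

Lemma ghost_only k (x : nat -> k) m n : (0 < n)%N -> (m %| n)%N ->
  ghost n (raw_only (pred1 m) x) = x m ^+ (n %/ m) *+ m.
Proof.
move=> n0 mn; rewrite /ghost (bigD1_seq m) ?divisors_uniq -?dvdn_divisors //=.
rewrite /raw_only /= eqxx big_seq_cond big1 ?addr0 // => d /andP[].
by rewrite -dvdn_divisors // => dn /negPf->; rewrite expr0_div // mul0rn.
Qed.

Lemma ghost_only_proper k (x : nat -> k) m n : (0 < n)%N -> (n < m)%N ->
  ghost n (raw_only (pred1 m) x) = 0.
Proof.
move=> n0 nm; rewrite /ghost big_seq big1 // => d; rewrite -dvdn_divisors // => dn.
rewrite /raw_only /= ltn_eqF ?expr0_div ?mul0rn //.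
exact: leq_ltn_trans (dvdn_leq n0 dn) nm.
Qed.

(** The right-hand side is spread out to a vector supported at [m], so that [raw_transfer] applies:
    at proper divisors of [m] both ghost components vanish, and at [m] both equal m w_m(c) x_m. *)
Lemma raw_mul_only k (c x : nat -> k) m : (0 < m)%N ->
  raw_mul c (raw_only (pred1 m) x) m = ghost m c * x m.
Proof.
move=> m0; pose R (k : comPzRingType) (xs : nat -> nat -> k) :=
  raw_only (pred1 m) (fun=> ghost m (xs 0%N) * xs 1%N m).
rewrite (@raw_transfer (fun k xs => raw_mul (xs 0%N) (raw_only (pred1 m) (xs 1%N)))
  R m m0 _ _ _ k (fun i => if i == 0%N then c else x)) => [|k' l h xs|k' l h xs|].
- by rewrite /R /raw_only /= eqxx.
- by rewrite raw_mul_nat raw_only_nat.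
- rewrite /R raw_only_nat; congr raw_only; apply: funext => d.
  by rewrite /= rmorphM rmorph_ghost.
move=> k' xs n n0 nm; rewrite ghost_mul //.
have [->|ne] := eqVneq n m; last first.
  have ltnm : (n < m)%N by rewrite ltn_neqAle ne dvdn_leq.
  by rewrite !ghost_only_proper // mulr0.
by rewrite !ghost_only // divnn m0 !expr1 mulrnAr.
Qed.

Lemma raw_add_lead k (x y : nat -> k) m : (0 < m)%N ->
  raw_add (raw_only (pred1 m) x) (raw_only (pred1 m) y) m = x m + y m.
Proof.
move=> m0; pose R (k : comPzRingType) (xs : nat -> nat -> k) :=
  raw_only (pred1 m) (fun=> xs 0%N m + xs 1%N m).
rewrite (@raw_transfer (fun k xs =>
    raw_add (raw_only (pred1 m) (xs 0%N)) (raw_only (pred1 m) (xs 1%N)))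
  R m m0 _ _ _ k (fun i => if i == 0%N then x else y)) => [|k' l h xs|k' l h xs|].
- by rewrite /R /raw_only /= eqxx.
- by rewrite raw_add_nat !raw_only_nat.
- rewrite /R raw_only_nat; congr raw_only; apply: funext => d.
  by rewrite /= rmorphD.
move=> k' xs n n0 nm; rewrite ghost_add //.
have [->|ne] := eqVneq n m; last first.
  have ltnm : (n < m)%N by rewrite ltn_neqAle ne dvdn_leq.
  by rewrite !ghost_only_proper // addr0.
by rewrite !ghost_only // divnn m0 !expr1 mulrnDl.
Qed.

End RawSupport.

(** * Leading coordinates, and membership in [VaVb a b] *)

Section WittCoordinates.
Variables (S : truncset) (k : comPzRingType).
Implicit Types x y : witt S k.

Lemma wcoefD x y n : S n -> wcoef (x + y) n = raw_add (wcoef x) (wcoef y) n.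
Proof. exact: wcoef_mkwitt. Qed.

Lemma wcoefM x y n : S n -> wcoef (x * y) n = raw_mul (wcoef x) (wcoef y) n.
Proof. exact: wcoef_mkwitt. Qed.

Lemma wcoef0 n : wcoef (0 : witt S k) n = 0.
Proof. by rewrite -mk0 /wcoef; case: insub. Qed.

(** Divisibility is the relevant order: coordinate [m] of a sum or product depends only on the
    coordinates at divisors of [m]. *)
Definition vanish_below m x :=
  forall d, (d %| m)%N -> d != m -> wcoef x d = 0.

Lemma vanish_only m x : vanish_below m x ->
  forall d, (d %| m)%N -> wcoef x d = raw_only (pred1 m) (wcoef x) d.
Proof.
by move=> x0 d dm; rewrite /raw_only /=; case: eqVneq => // /(x0 d dm).
Qed.

Lemma wcoefD_lead m x y : S m -> vanish_below m x -> vanish_below m y ->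
  wcoef (x + y) m = wcoef x m + wcoef y m.
Proof.
move=> Sm x0 y0; have m0 := truncset_gt0 Sm.
rewrite wcoefD // (eq_raw_add m0 (vanish_only x0) (vanish_only y0)).
exact: raw_add_lead.
Qed.

Lemma wcoefZ_lead m (c : bigwitt k) x : S m -> vanish_below m x ->
  wcoef (c *: x) m = wghost m c * wcoef x m.
Proof.
move=> Sm x0; have m0 := truncset_gt0 Sm.
rewrite [LHS]wcoefM // (eq_raw_mul m0 _ (vanish_only x0) (x' := wcoef c)); last first.
  by move=> d dm; rewrite wcoef_mkwitt //; apply: truncset_dvd Sm dm.
exact: raw_mul_only.
Qed.

Variables a b : nat.

(** A vector is the sum of its part supported on the multiples of [a], which comes from V_a, and of
    the rest, which comes from V_b if it is supported on multiples of [b]. Conversely, at [n] and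
    all its divisors the coordinates of both summands vanish. *)
Lemma VaVbP x : reflect
  (forall n, S n -> ~~ (a %| n)%N -> ~~ (b %| n)%N -> wcoef x n = 0)
  (x \in VaVb a b).
Proof.
have wV_coef c (y : witt (divset S c) k) n : S n -> ~~ (c %| n)%N -> wcoef (wV c y) n = 0.
  by move=> Sn cn; rewrite wcoef_mkwitt // /raw_V (negPf cn).
have ndvd c n d : ~~ (c %| n)%N -> (d %| n)%N -> ~~ (c %| d)%N.
  by move=> cn dn; apply: contra cn => /dvdn_trans; apply.
apply: (iffP (asboolP _)) => [[y [z ->]] n Sn an bn|x0].
  rewrite wcoefD_lead ?wV_coef ?addr0 // => d dn _.
    by apply: wV_coef (ndvd _ _ _ an dn); apply: truncset_dvd Sn dn.
  by apply: wV_coef (ndvd _ _ _ bn dn); apply: truncset_dvd Sn dn.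
exists (mkwitt _ (fun n => wcoef x (a * n))).
(* Common multiples of [a] and [b] are left to V_a, which keeps the supports disjoint. *)
exists (mkwitt _ (fun n => if (a %| b * n)%N then 0 else wcoef x (b * n))).
rewrite !wV_mk mkD -[LHS]wcoefK; apply: eq_mkwitt => n Sn.
have n0 := truncset_gt0 Sn.
rewrite -[LHS](raw_add_onlyC (fun d => a %| d)%N) //.
apply: eq_raw_add => // d dn; rewrite /raw_V /raw_only /=.
  by case: ifP => // ad; rewrite mulnC divnK.
have [ad|ad] := boolP (a %| d)%N.
  by case: ifP => // bd; rewrite mulnC divnK // ad.
case: ifPn => bd; first by rewrite mulnC divnK // (negPf ad).
by apply: x0 => //; apply: truncset_dvd Sn dn.
Qed.

End WittCoordinates.

(** * Surjectivity of the ghost maps over a perfect field *)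

Section GhostSurjective.
Variable k : comPzRingType.
Hypothesis k_perf : perfect_field k.

Lemma field_mulf_eq0 (x y : k) : x * y = 0 -> x != 0 -> y = 0.
Proof.
move=> xy x0; have [_ inv _] := k_perf; have [z xz] := inv x x0.
by rewrite -[y]mul1r -xz mulrAC xy mul0r.
Qed.

(** By induction, splitting off the smallest prime factor: a field has no zero divisors. *)
Lemma natr_neq0_char (d : nat) : (0 < d)%N ->
  (forall p, prime p -> (p %| d)%N -> p%:R != 0 :> k) -> d%:R != 0 :> k.
Proof.
have [k1 _ _] := k_perf.
elim/ltn_ind: d => d IH d0 dp; have [d1|d1] := leqP d 1.
  by have -> : d = 1%N by apply/eqP; rewrite eqn_leq d1 d0.
have pr := pdiv_prime d1; have pd := pdiv_dvd d.
apply/eqP => e; have := dp _ pr pd => p0.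
have q0 : (0 < d %/ pdiv d)%N by rewrite divn_gt0 ?pdiv_gt0 //; apply: dvdn_leq d0 pd.
have /negP[] : (d %/ pdiv d)%:R != 0 :> k.
  apply: IH => // [|p pp pq]; first exact: ltn_Pdiv (prime_gt1 pr) d0.
  by apply: (dp p pp); rewrite -(divnK pd) dvdn_mulr.
apply/eqP/(field_mulf_eq0 _ p0); by rewrite -natrM mulnC divnK.
Qed.

(* Use the coordinate of c at the largest divisor d of m invertible in k: the
   other factor m/d is a power of the characteristic exponent, and perfectness
   provides the root. *)
Lemma wghost_surj m (t : k) : (0 < m)%N -> exists c : bigwitt k, wghost m c = t.
Proof.
move=> m0; have [k1 inv root] := k_perf.
suff [d [dm d0 u]] : exists d, [/\ (d %| m)%N, d%:R != 0 :> k
    & forall s : k, exists u, u ^+ (m %/ d) = s].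
  have [v dv] := inv _ d0; have [u' eu'] := u (t * v).
  (* A vector supported at [d] has w_m = d u'^(m/d), so [u'] is taken to be a root of t/d. *)
  exists (mkwitt _ (raw_only (pred1 d) (fun=> u'))).
  rewrite /wghost (@eq_ghost _ _ _ (raw_only (pred1 d) (fun=> u'))) // => [|e em].
    by rewrite ghost_only // eu' -mulr_natr -mulrA [v * _]mulrC dv mulr1.
  by rewrite wcoef_mkwitt //= (dvdn_gt0 m0 em).
(* In characteristic 0 take d = m; in characteristic [p], the prime-to-[p] part of [m]. *)
have [[p [pr p0]]|no_p] := pselect (exists p, prime p /\ p%:R = 0 :> k); last first.
  exists m; split=> // [|s]; last by exists s; rewrite divnn m0 expr1.
  by apply: natr_neq0_char => // p pr _; apply/eqP => p0; apply: no_p; exists p.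
exists (m`_p^')%N; split=> [||s]; first exact: dvdn_part.
  have cop : coprime (m`_p^') p.
    by rewrite coprime_sym (@pnat_coprime p) ?pnat_id ?part_pnat.
  have /(coprimeP _ (part_gt0 _ _))[[u v] /= e] := cop.
  apply: contra k1 => /eqP d0.
  have /(congr1 (fun i : nat => i%:R : k)) : (u * m`_p^' = v * p + 1)%N.
    by rewrite addnC -e subnK // ltnW // -subn_gt0 e.
  by rewrite natrD !natrM d0 p0 !mulr0 add0r => /esym/eqP.
rewrite -{1}(partnC p m0) mulnK ?part_gt0 // p_part.
elim: (logn p m) s => [|e IH] s; first by exists s; rewrite expn0 expr1.
have [u eu] := IH s; have [v ev] := root p pr p0 u.
by exists v; rewrite expnS exprM ev.
Qed.

End GhostSurjective.

(** * The filtration of the quotient by vanishing coordinates *)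

Section CuspFiltration.
Variables (S : truncset) (k : comPzRingType) (a b : nat) (ms : seq nat).
Hypotheses (ms_sorted : sorted gtn ms)
  (ms_mem : forall m, (m \in ms) = [&& S m, ~~ (a %| m)%N & ~~ (b %| m)%N]).

Local Notation M := (cuspquot S k a b).
Let proj : witt S k -> M := quotmod_pi (VaVb_submod S k a b).

Let ms_S m : m \in ms -> S m.
Proof. by rewrite ms_mem => /and3P[]. Qed.

Let ms_dvd m d : m \in ms -> (d %| m)%N -> d \in ms.
Proof.
rewrite !ms_mem => /and3P[Sm am bm] dm; rewrite (truncset_dvd Sm dm) /=.
by apply/andP; split; [apply: contra am | apply: contra bm] => /dvdn_trans; apply.
Qed.

(** As [ms] decreases, everything dropped exceeds [m], hence cannot divide it. *)
Let drop_ms_dvd i m d : m \in drop i ms -> (d %| m)%N -> d \in drop i ms.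
Proof.
move=> mi dm; have mms := mem_drop mi.
have := ms_dvd mms dm; rewrite -{1}(cat_take_drop i ms) mem_cat => /orP[dt|//].
have : pairwise gtn ms.
  by rewrite -sorted_pairwise // => x y z /= yx zx; apply: ltn_trans zx yx.
rewrite -(cat_take_drop i ms) pairwise_cat => /andP[/allrelP/(_ _ _ dt mi) /= ltmd _].
have := dvdn_leq (truncset_gt0 (ms_S mms)) dm.
by rewrite leqNgt ltmd.
Qed.

Let proj0 : proj 0 = 0.
Proof. by apply: (addrI (proj 0)); rewrite -[LHS]quotmod_piD !addr0. Qed.

(** An arbitrary representative; by [cusp_coef_proj] its coordinates at indices in [ms] depend only
    on the class. *)
Definition cusp_rep (q : M) : witt S k := sval (cid (quotmod_piP q)).

Lemma cusp_repK q : proj (cusp_rep q) = q.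
Proof. by rewrite /cusp_rep; case: cid => x /= ->. Qed.

Definition cusp_coef (q : M) (m : nat) : k := wcoef (cusp_rep q) m.

(** Two representatives differ by an element of [VaVb a b], whose coordinates vanish at every
    divisor of [m], since these again lie in [ms]. *)
Lemma cusp_coef_proj x m : m \in ms -> cusp_coef (proj x) m = wcoef x m.
Proof.
move=> mms; have Sm := ms_S mms; have m0 := truncset_gt0 Sm.
have /quotmod_pi_eq/VaVbP z0 := cusp_repK (proj x).
rewrite /cusp_coef -[X in wcoef X](subrK x) wcoefD //.
rewrite -[RHS]raw_add0 //; apply: eq_raw_add => // d dm.
by have := ms_dvd mms dm; rewrite ms_mem => /and3P[]; apply: z0.
Qed.

Lemma cusp_coefD m p q : m \in ms ->
  vanish_below m (cusp_rep p) -> vanish_below m (cusp_rep q) ->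
  cusp_coef (p + q) m = cusp_coef p m + cusp_coef q m.
Proof.
move=> mms p0 q0.
rewrite -{1}(cusp_repK p) -{1}(cusp_repK q) -[proj _ + _]quotmod_piD.
by rewrite cusp_coef_proj // wcoefD_lead // ms_S.
Qed.

Lemma cusp_coefZ m c q : m \in ms -> vanish_below m (cusp_rep q) ->
  cusp_coef (c *: q) m = wghost m c * cusp_coef q m.
Proof.
move=> mms q0; rewrite -{1}(cusp_repK q).
have -> : c *: proj (cusp_rep q) = proj (c *: cusp_rep q) by apply: quotmod_piZ.
by rewrite cusp_coef_proj // wcoefZ_lead // ms_S.
Qed.

Lemma cusp_coef_eq0 q : (forall m, m \in ms -> cusp_coef q m = 0) -> q = 0.
Proof.
move=> q0; rewrite -[q]cusp_repK -proj0; apply/quotmod_pi_eq.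
rewrite subr0; apply/VaVbP => n Sn an bn; apply: q0.
by rewrite ms_mem Sn an bn.
Qed.

(** Only the coordinates at the [i] largest indices are free, so the filtration grows from 0 to the
    whole module. *)
Definition cusp_fil (i : nat) : {pred M} :=
  fun q => all (fun m => cusp_coef q m == 0) (drop i ms).

Lemma cusp_filP i q :
  reflect (forall m, m \in drop i ms -> cusp_coef q m = 0) (q \in cusp_fil i).
Proof. by apply: (iffP allP) => q0 m /q0 /eqP. Qed.

Lemma cusp_coef0 m : m \in ms -> cusp_coef 0 m = 0.
Proof. by move=> mms; rewrite -proj0 cusp_coef_proj // wcoef0. Qed.

Lemma cusp_fil_submod i : submod_closed (cusp_fil i).
Proof.
split=> [|c p q /cusp_filP p0 /cusp_filP q0]; apply/cusp_filP => m mi.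
  exact/cusp_coef0/(mem_drop mi).
have below r : (forall m, m \in drop i ms -> cusp_coef r m = 0) ->
    vanish_below m (cusp_rep r).
  by move=> r0 d dm _; apply/r0/(drop_ms_dvd mi).
have cp0 n : n \in drop i ms -> cusp_coef (c *: p) n = 0.
  move=> ni; rewrite cusp_coefZ ?(mem_drop ni) ?p0 ?mulr0 // => d dn _.
  exact/p0/(drop_ms_dvd ni).
rewrite cusp_coefD ?(mem_drop mi) ?cp0 ?q0 ?addr0 //; exact: below.
Qed.

Lemma cusp_filS i q : (i < size ms)%N ->
  (q \in cusp_fil i) = (cusp_coef q (nth 0%N ms i) == 0) && (q \in cusp_fil i.+1).
Proof. by move=> lti; rewrite -!topredE /= /cusp_fil (drop_nth 0%N). Qed.

Lemma cusp_fil_vanish i q : (i < size ms)%N -> q \in cusp_fil i.+1 ->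
  vanish_below (nth 0%N ms i) (cusp_rep q).
Proof.
move=> lti /cusp_filP q0 d dm dne; apply: q0.
have : d \in drop i ms.
  by apply: drop_ms_dvd dm; rewrite (drop_nth 0%N) // mem_head.
by rewrite (drop_nth 0%N) // inE (negPf dne).
Qed.

Lemma cusp_ghost_filtration : ghost_filtration M ms.
Proof.
exists cusp_fil; split=> [i _|q|q|i lti q|i lti]; first exact: cusp_fil_submod.
- apply/cusp_filP/eqP => [q0|-> m]; last by rewrite drop0; apply: cusp_coef0.
  by apply: cusp_coef_eq0 => m; have := q0 m; rewrite drop0.
- by rewrite -topredE /= /cusp_fil drop_size.
- by rewrite cusp_filS // => /andP[].
have mms := mem_nth 0%N lti; set m := nth 0%N ms i in mms *.
(* On [cusp_fil i.+1], coordinate [m] is a leading one: it is additive, and W(k) acts on it through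
   w_m. *)
exists (cusp_coef^~ m); split=> [p q pF qF|c q qF|y|q qF].
- by rewrite cusp_coefD //; apply: cusp_fil_vanish.
- by rewrite cusp_coefZ //; apply: cusp_fil_vanish.
(* The vector supported at [m] lies in [cusp_fil i.+1] because [m] does not recur later in [ms]. *)
- exists (proj (mkwitt S (raw_only (pred1 m) (fun=> y)))).
    apply/cusp_filP => n ni; rewrite cusp_coef_proj ?(mem_drop ni) //.
    rewrite wcoef_mkwitt ?ms_S ?(mem_drop ni) // /raw_only /=.
    case: eqP => // en; have : uniq ms.
      by move: ms_sorted; rewrite gtn_sorted_uniq_geq => /andP[].
    rewrite -(cat_take_drop i ms) cat_uniq => /and3P[_ _].
    by rewrite (drop_nth 0%N) //= -/m -en ni.
  by rewrite cusp_coef_proj // wcoef_mkwitt ?ms_S // /raw_only /= eqxx.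
by rewrite cusp_filS // qF andbT; split=> /eqP.
Qed.

End CuspFiltration.

(* Over an arbitrary commutative ring k the length is counted in units of k:
   the module is filtered with as many subquotients k (W(k) acting through the
   ghost maps w_m) as asserted, one for each m in S divisible by neither a nor b.
   The usual length over W(k) can differ (k = Z, or k an imperfect field); it
   is the asserted number when k is a perfect field. *)
Theorem corollary1p7 (a b r : nat) (k : comPzRingType)
    (ha : (1 < a)%N) (hab : (a < b)%N) (cab : coprime a b) :
  let S := Sabr a b r in
  let N := ((2 * r + 1) * (a - 1) * (b - 1) %/ 2)%N in
  (exists ms : seq nat,
     [/\ uniq ms,
         forall m, (m \in ms) = [&& S m, ~~ (a %| m)%N & ~~ (b %| m)%N],
         size ms = N
       & ghost_filtration (cuspquot S k a b) ms]) /\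
  (perfect_field k -> has_length (cuspquot S k a b) N).
Proof.
move=> S N; have b1 : (1 < b)%N := ltn_trans ha hab.
have [ms [ms_sorted ms_mem ms_size]] := Sabr_coprime_part ha b1 cab r.
have fil := cusp_ghost_filtration k ms_sorted ms_mem.
split=> [|k_perf].
  exists ms; split=> //.
  by move: ms_sorted; rewrite gtn_sorted_uniq_geq => /andP[].
have [F [Fsub F0 Fn FS Fiso]] := fil; rewrite -[N]ms_size.
have [k1 inv _] := k_perf.
apply: (has_length_filtration Fsub F0 Fn FS Fiso k1) => i y z lti y0.
have [v yv] := inv y y0.
have m0 : (0 < nth 0 ms i)%N.
  by have := mem_nth 0%N lti; rewrite ms_mem => /and3P[/truncset_gt0].
(* As [v] is the inverse of [y], this [c] carries [y] to [z], so the piece is simple. *)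
have [c ec] := wghost_surj k_perf (z * v) m0.
by exists c; rewrite ec -mulrA [v * y]mulrC yv mulr1.
Qed.
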